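(* Let $p$ be a prime, $K$ a commutative ring (with $1$) of characteristic $p$, and $G$ a nonabelian locally finite $p$-group. The symmetric units of the group algebra $KG$ form a multiplicative group if and only if $p=2$ and $G$ is the direct product of an elementary abelian group and a group $H$ for which one of the following holds: (i) $H$ has an abelian subgroup $A$ of index $2$ and an element $b$ of order $4$ such that conjugation by $b$ inverts each element of $A$; (ii) $H$ is the direct product of a quaternion group of order $8$ and a cyclic group of order $4$, or the direct product of two quaternion groups of order $8$; (iii) $H$ is the central product of the group $\langle\, x,y \mid x^4=y^4=1,\ x^2=[y,x]\,\rangle$ with a quaternion group of order $8$, the nontrivial element common to the two central factors being $x^2y^2$; (iv) $H$ is isomorphic to one of the groups $$H_{32}=\bigl\langle\, x,y,u \bigm| x^4=y^4=1,\ x^2=[y,x],\ y^2=u^2=[u,x],\ x^2y^2=[u,y]\,\bigr\rangle,$$ $$H_{245}=\bigl\langle\, x,y,u,v \bigm| x^4=y^4=[v,u]=1,\ x^2=v^2=[y,x]=[v,y],\ y^2=u^2=[u,x],\ x^2y^2=[u,y]=[v,x]\,\bigr\rangle.$$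
   Context: For a group $G$ and a commutative ring $K$ with $1$, $U(KG)$ denotes the group of units of the group algebra $KG$. The map $g\mapsto g^{-1}$ on $G$ extends $K$-linearly to an anti-automorphism $a\mapsto a^*$ of $KG$. An element $a\in KG$ is called symmetric if $a^*=a$. A symmetric unit is an element of $U(KG)$ that is symmetric; ''the symmetric units form a multiplicative group'' means that the set of symmetric units is a subgroup of $U(KG)$. Commutators are $[a,b]=a^{-1}b^{-1}ab$. The elementary abelian factor (here an elementary abelian $2$-group) may be trivial or infinite. In (iii), the central product is the quotient of the direct product of the two groups obtained by identifying the central element $x^2y^2$ of the first group with the unique element of order $2$ of the quaternion group. *)

(* Defs.v *)
From Stdlib Require List.
From HB Require Import structures.
From mathcomp Require Import all_boot all_algebra all_fingroup all_solvable.
From mathcomp Require Import finmap monalg boolp.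

Set Implicit Arguments.
Unset Strict Implicit.
Unset Printing Implicit Defensive.

Import GRing.Theory.

(* The group algebra KG.  [monalg] gives the free K-module {malg K[G]} on any  *)
(* choiceType, but its product only on monoids without nontrivial units; the   *)
(* alias below carries the convolution product for a group G.                  *)

Definition group_algebra (K : comNzRingType) (G : groupType) := {malg K[G]}.

Notation "{ 'group_algebra' K [ G ] }" := (group_algebra K G)
  (at level 0, K, G at level 2, format "{ 'group_algebra'  K [ G ] }")
  : type_scope.

HB.instance Definition _ K G := GRing.Lmodule.on {group_algebra K[G]}.

Section GroupAlgebra.
Local Open Scope ring_scope.
Local Open Scope fset_scope.
Context (K : comNzRingType) (G : groupType).
Implicit Types (a b c : {malg K[G]}) (x y : G).

Definition gaone : {malg K[G]} := << 1%g >>.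

Definition gamul a b : {malg K[G]} :=
  \sum_(x <- msupp a) \sum_(y <- msupp b) << a@_x * b@_y *g (x * y)%g >>.

(* The K-linear extension of x |-> x^-1, written a^* in the literature. *)
Definition gastar a : {malg K[G]} := \sum_(x <- msupp a) << a@_x *g x^-1%g >>.

Lemma gamulw (d1 d2 : {fset G}) a b :
  msupp a `<=` d1 -> msupp b `<=` d2 ->
  gamul a b = \sum_(x <- d1) \sum_(y <- d2) << a@_x * b@_y *g (x * y)%g >>.
Proof.
move=> le_d1 le_d2; rewrite /gamul (big_fset_incl _ le_d1) /=.
  apply/eq_bigr=> x _; apply/big_fset_incl => // y _ /mcoeff_outdom ->.
  by rewrite mulr0 monalgU0.
move=> x _ /mcoeff_outdom ax.
by rewrite big1 => // y _; rewrite ax mul0r monalgU0.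
Qed.

Lemma gamulUU r s x y :
  gamul << r *g x >> << s *g y >> = << r * s *g (x * y)%g >>.
Proof. by rewrite (gamulw msuppU_le msuppU_le) !big_seq_fset1 !mcoeffUU. Qed.

Lemma gamulDl : left_distributive gamul +%R.
Proof.
move=> a b c; have suppc := fsubset_refl (msupp c).
rewrite [gamul a c](gamulw (fsubsetUl _ (msupp b)) suppc).
rewrite [gamul b c](gamulw (fsubsetUr (msupp a) _) suppc).
rewrite (gamulw (msuppD_le _ _) suppc).
rewrite -big_split /=; apply/eq_bigr=> x _.
rewrite -big_split /=; apply/eq_bigr=> y _.
by rewrite mcoeffD mulrDl monalgUD.
Qed.

Lemma gamulDr : right_distributive gamul +%R.
Proof.
move=> c a b; have suppc := fsubset_refl (msupp c).
rewrite [gamul c a](gamulw suppc (fsubsetUl _ (msupp b))).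
rewrite [gamul c b](gamulw suppc (fsubsetUr (msupp a) _)).
rewrite (gamulw suppc (msuppD_le _ _)).
rewrite -big_split /=; apply/eq_bigr=> x _.
rewrite -big_split /=; apply/eq_bigr=> y _.
by rewrite mcoeffD mulrDr monalgUD.
Qed.

Lemma gamul0 : left_zero 0 gamul.
Proof. by move=> a; rewrite /gamul msupp0 big_seq_fset0. Qed.

Lemma gamulr0 : right_zero 0 gamul.
Proof. by move=> a; rewrite /gamul big1 // => x _; rewrite msupp0 big_seq_fset0. Qed.

Lemma gamul_suml (I : Type) (s : seq I) (F : I -> {malg K[G]}) b :
  gamul (\sum_(i <- s) F i) b = \sum_(i <- s) gamul (F i) b.
Proof. exact: (big_morph (gamul^~ b) (fun _ _ => gamulDl _ _ _) (gamul0 _)). Qed.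

Lemma gamul_sumr (I : Type) (s : seq I) (F : I -> {malg K[G]}) b :
  gamul b (\sum_(i <- s) F i) = \sum_(i <- s) gamul b (F i).
Proof. exact: (big_morph (gamul b) (fun _ _ => gamulDr _ _ _) (gamulr0 _)). Qed.

Lemma gamulA : associative gamul.
Proof.
move=> a b c; rewrite (monalgE a) !gamul_suml; apply/eq_bigr => x _.
rewrite (monalgE b) gamul_sumr !gamul_suml gamul_sumr; apply/eq_bigr => y _.
rewrite (monalgE c) !gamul_sumr; apply/eq_bigr => z _.
by rewrite !gamulUU mulrA mulgA.
Qed.

Lemma gamul1 : left_id gaone gamul.
Proof.
move=> a; rewrite {1 2}(monalgE a) gamul_sumr; apply/eq_bigr => x _.
by rewrite gamulUU mul1r mul1g.
Qed.

Lemma gamulr1 : right_id gaone gamul.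
Proof.
move=> a; rewrite {1 2}(monalgE a) gamul_suml; apply/eq_bigr => x _.
by rewrite gamulUU mulr1 mulg1.
Qed.

Lemma gaone_neq0 : gaone != 0.
Proof. by rewrite monalgU_eq0 oner_neq0. Qed.

HB.instance Definition _ := GRing.Zmodule_isNzRing.Build {group_algebra K[G]}
  gamulA gamul1 gamulr1 gamulDl gamulDr gaone_neq0.

Implicit Type u : {group_algebra K[G]}.

Definition gaunit : pred {group_algebra K[G]} :=
  fun u => `[< exists v, v * u = 1 /\ u * v = 1 >].

Definition gainv u : {group_algebra K[G]} :=
  if pselect (exists v, v * u = 1 /\ u * v = 1) is left ex
  then projT1 (cid ex) else u.

Lemma gamulV : {in gaunit, left_inverse 1 gainv *%R}.
Proof.
move=> u /asboolP uU; rewrite /gainv; case: pselect => // ex.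
by case: (cid ex) => v [].
Qed.

Lemma gamulrV : {in gaunit, right_inverse 1 gainv *%R}.
Proof.
move=> u /asboolP uU; rewrite /gainv; case: pselect => // ex.
by case: (cid ex) => v [].
Qed.

Lemma gaunitP u v : v * u = 1 /\ u * v = 1 -> gaunit u.
Proof. by move=> uv; apply/asboolP; exists v. Qed.

Lemma gainv_out : {in [predC gaunit], gainv =1 id}.
Proof. by move=> u /asboolP nU; rewrite /gainv; case: pselect. Qed.

HB.instance Definition _ :=
  GRing.NzRing_hasMulInverse.Build {group_algebra K[G]}
    gamulV gamulrV gaunitP gainv_out.

Definition symmetric_unit : pred {group_algebra K[G]} :=
  fun u => (u \is a GRing.unit) && (gastar u == u).

End GroupAlgebra.

(* [S] is a subgroup of the unit group of [R]; [GRing.mulr_closed] includes    *)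
(* the membership of 1.                                                        *)
Definition unit_subgroup (R : unitRingType) (S : {pred R}) :=
  [/\ {subset S <= GRing.unit}, GRing.mulr_closed S & GRing.invr_closed S].

Local Open Scope group_scope.

Definition commutative_group (G : groupType) := forall x y : G, x * y = y * x.

Definition in_generated (G : groupType) (s : seq G) (x : G) :=
  forall S : {pred G}, group_closed S -> {subset s <= S} -> x \in S.

Definition locally_finite (G : groupType) :=
  forall s : seq G, exists t : seq G, forall x, in_generated s x -> x \in t.

Definition is_p_group (p : nat) (G : groupType) :=
  forall x : G, exists n, x ^+ (p ^ n) = 1.

Definition elementary_abelian (p : nat) (E : groupType) :=
  commutative_group E /\ forall x : E, x ^+ p = 1.

Definition has_order (G : groupType) (x : G) (n : nat) :=
  [/\ (0 < n)%N, x ^+ n = 1 & forall m, (0 < m < n)%N -> x ^+ m <> 1].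

(* There are exactly two left cosets, [A] itself and [t * A]. *)
Definition index2 (G : groupType) (A : {pred G}) :=
  exists2 t : G, t \notin A & forall x, x \in A \/ t^-1 * x \in A.

Definition isomorphic (G H : groupType) :=
  exists f : {multiplicative G -> H}, bijective f.

(* The group obtained from [T] by identifying the elements related by [R]:     *)
(* the quotient of [T] by the least congruence containing [R] and the group    *)
(* laws.  On formal words this is the group presented by the relations [R];    *)
(* on a group it is the quotient by the normal closure of the l^-1 * r with    *)
(* R l r.                                                                      *)

Inductive group_congr (T : baseGroupType) (R : T -> T -> Prop) :
    T -> T -> Prop :=
  | GCrel x y : R x y -> group_congr R x y
  | GCrefl x : group_congr R x x
  | GCsym x y : group_congr R x y -> group_congr R y x
  | GCtrans x y z :
      group_congr R x y -> group_congr R y z -> group_congr R x z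
  | GCmul x x' y y' : group_congr R x x' -> group_congr R y y' ->
      group_congr R (x * y) (x' * y')
  | GCinv x x' : group_congr R x x' -> group_congr R x^-1 x'^-1
  | GCmulA x y z : group_congr R (x * (y * z)) (x * y * z)
  | GCmul1 x : group_congr R (1 * x) x
  | GCmulV x : group_congr R (x^-1 * x) 1.

Section GroupQuotient.
Context (T : baseGroupType) (R : T -> T -> Prop).

Definition group_congrb : rel {classic T} := fun x y => `[< group_congr R x y >].

Lemma group_congrb_refl : reflexive group_congrb.
Proof. by move=> x; apply/asboolP/GCrefl. Qed.

Lemma group_congrb_sym : symmetric group_congrb.
Proof. by move=> x y; apply/asboolP/asboolP; apply: GCsym. Qed.

Lemma group_congrb_trans : transitive group_congrb.
Proof. by move=> y x z /asboolP xy /asboolP yz; apply/asboolP/(GCtrans xy). Qed.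

Canonical group_congr_equiv :=
  EquivRel group_congrb group_congrb_refl group_congrb_sym group_congrb_trans.

Definition group_quotient := {eq_quot group_congr_equiv}%qT.

HB.instance Definition _ := Choice.on group_quotient.

Definition gclass (x : T) : group_quotient := (\pi_({eq_quot group_congr_equiv}) x)%qT.

Definition grepr (u : group_quotient) : T := generic_quotient.repr u.

Lemma greprK : cancel grepr gclass.
Proof. by move=> u; exact: reprK. Qed.

Lemma gclassP x y : gclass x = gclass y <-> group_congr R x y.
Proof.
split=> [/(@eqmodP _ group_congr_equiv)/asboolP // | xy].
by apply/(@eqmodP _ group_congr_equiv)/asboolP.
Qed.

Definition gqone := gclass 1.
Definition gqmul u v := gclass (grepr u * grepr v).
Definition gqinv u := gclass (grepr u)^-1.

Lemma gqmulE x y : gqmul (gclass x) (gclass y) = gclass (x * y).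
Proof. by apply/gclassP/GCmul; apply/gclassP; rewrite greprK. Qed.

Lemma gqinvE x : gqinv (gclass x) = gclass x^-1.
Proof. by apply/gclassP/GCinv/gclassP; rewrite greprK. Qed.

Lemma gqmulA : associative gqmul.
Proof.
move=> u v w; rewrite -[u]greprK -[v]greprK -[w]greprK !gqmulE.
exact/gclassP/GCmulA.
Qed.

Lemma gqmul1 : left_id gqone gqmul.
Proof. by move=> u; rewrite -[u]greprK gqmulE; apply/gclassP/GCmul1. Qed.

Lemma gqmulV : left_inverse gqone gqinv gqmul.
Proof. by move=> u; rewrite -[u]greprK gqinvE gqmulE; apply/gclassP/GCmulV. Qed.

Lemma gqmulrV : right_inverse gqone gqinv gqmul.
Proof.
move=> u; rewrite -[LHS]gqmul1 -{1}(gqmulV (gqinv u)) -gqmulA.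
by rewrite [gqmul (gqinv u) _]gqmulA gqmulV gqmul1 gqmulV.
Qed.

Lemma gqmulr1 : right_id gqone gqmul.
Proof. by move=> u; rewrite -(gqmulV u) gqmulA gqmulrV gqmul1. Qed.

HB.instance Definition _ := isGroup.Build group_quotient
  gqmulA gqmul1 gqmulr1 gqmulV gqmulrV.

End GroupQuotient.

Inductive word (X : Type) :=
  | Gen of X
  | WordOne
  | WordMul of word X & word X
  | WordInv of word X.

HB.instance Definition _ X := hasMul.Build (word X) (@WordMul X).
HB.instance Definition _ X := hasOne.Build (word X) (@WordOne X).
HB.instance Definition _ X := hasInv.Build (word X) (@WordInv X).

Definition presented (X : Type) (rels : seq (word X * word X)) :=
  group_quotient (fun l r => List.In (l, r) rels).

Variant gen2 := X2 | Y2.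
Variant gen3 := X3 | Y3 | U3.
Variant gen4 := X4 | Y4 | U4 | V4.

Definition rels16 : seq (word gen2 * word gen2) :=
  let x := Gen X2 in let y := Gen Y2 in
  [:: (x ^+ 4, 1); (y ^+ 4, 1); (x ^+ 2, [~ y, x])].

Definition rels32 : seq (word gen3 * word gen3) :=
  let x := Gen X3 in let y := Gen Y3 in let u := Gen U3 in
  [:: (x ^+ 4, 1); (y ^+ 4, 1);
      (x ^+ 2, [~ y, x]);
      (y ^+ 2, u ^+ 2); (y ^+ 2, [~ u, x]);
      (x ^+ 2 * y ^+ 2, [~ u, y])].

Definition rels245 : seq (word gen4 * word gen4) :=
  let x := Gen X4 in let y := Gen Y4 in let u := Gen U4 in let v := Gen V4 in
  [:: (x ^+ 4, 1); (y ^+ 4, 1); ([~ v, u], 1);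
      (x ^+ 2, v ^+ 2); (x ^+ 2, [~ y, x]); (x ^+ 2, [~ v, y]);
      (y ^+ 2, u ^+ 2); (y ^+ 2, [~ u, x]);
      (x ^+ 2 * y ^+ 2, [~ u, y]); (x ^+ 2 * y ^+ 2, [~ v, x])].

Definition P16 : groupType := presented rels16.
Definition H32 : groupType := presented rels32.
Definition H245 : groupType := presented rels245.

Definition P16_x2y2 : P16 := gclass _ (Gen X2 ^+ 2 * Gen Y2 ^+ 2).

(* Here x ^ y is y^-1 * x * y. *)
Definition inverted_by_order4 (H : groupType) :=
  exists (A : {pred H}) (b : H),
    [/\ group_closed A, {in A &, forall x y, x * y = y * x}, index2 A,
        has_order b 4 & {in A, forall a, a ^ b = a^-1}].

(* The ring 'Z_4 counts here as its additive group, which is the group         *)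
(* structure the library puts on it.                                           *)
Definition C4 : groupType := 'Z_4%type.
Definition Q8 : groupType := quaternion_gtype 8.

(* The central product of P16 and Q8 in which x^2 y^2 is identified with [z].  *)
Definition P16_central_Q8 (z : Q8) : groupType :=
  group_quotient (fun l r : P16 * Q8 => l = (P16_x2y2, 1) /\ r = (1, z)).

(* Main.v *)
Require Import Defs.
From Stdlib Require List.
From HB Require Import structures.
From mathcomp Require Import all_boot all_algebra all_fingroup all_solvable.
From mathcomp Require Import finmap monalg boolp classical_sets.

Set Implicit Arguments.
Unset Strict Implicit.
Unset Printing Implicit Defensive.

(** A product of two symmetric units a, b is symmetric exactly when ab = ba, so
the question is when the symmetric units commute. If x has order a power of p,
a power of c + x + x^-1 with exponent p^n is c + 2; with c = 0 for odd p and
c = 1 for p = 2 this makes c + x + x^-1 a symmetric unit ([trace_unit]). Hence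
all the traces x + x^-1 commute, and comparing coefficients in the two products
of a pair of traces turns this into a condition on G. For odd p the condition
is that G is abelian ([commutative_of_symmetric]). For p = 2 it is the
condition [good G]: involutions are central and, of two elements that do not
commute, one inverts the other or both have the same square, of order 2. It is
also sufficient, since traces and involutions span the symmetric elements
([symmetric_ind], [comm_of_good]).

It remains to classify the good nonabelian groups. If some element has order
greater than 4, then so has one that is not central, and every element outside
the centralizer A of the latter inverts A, which is the first structure in the
list ([good_large_order], [good_small_order]). Otherwise G has exponent 4, the
involutions and 1 form a central subgroup W, and G / W is a vector space V over
F_2 on which squaring induces a map q to W. It is quadratic, with the
commutator as polar form, and anisotropic: q(v) = 0 only for v = 0. Goodness
says that on each two-dimensional subspace of V the three values of q span at
most two dimensions. If q takes values outside the plane spanned by the squares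
of some u and w, where u inverts w and the two squares differ, then u inverts
the centralizer of w, which has index 2 ([large_square_span_inverted]). If no
such u and w exist, G is a product of a quaternion group and an elementary
abelian group ([unequal_squares_or_inverted]).

In the remaining case q takes values in F_2^2. A quadratic map on F_2^n is
recorded by a table: its values on a basis and those of the polar form on pairs
of basis vectors. Starting with the group of order 16 generated by u and w, the
generators of G are added one at a time; a finite computation over all tables
([normal_tables_extensible]) brings each anisotropic extension to one of six
further normal forms with three or four generators, and shows that there is
none with five. A complement in W of the plane of squares splits off as the
elementary abelian factor, and the other factor is the group with that table
([covered_split]). For two of the seven tables that group is inverted; the
others are the groups named in the theorem, and these are good because any three
nonzero vectors of F_2^2 with no two equal have sum zero
([good_of_plane_squares]). *)

Local Open Scope group_scope.

(** * Good groups *)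

Definition involutions_central (G : groupType) :=
  forall t x : G, t ^+ 2 = 1 -> commute t x.

(** In characteristic 2 this says that the symmetric elements of the group
algebra commute with each other. *)
Definition good (G : groupType) :=
  involutions_central G /\
  forall x y : G, [\/ commute x y, x ^ y = x^-1, y ^ x = y^-1
                    | x ^+ 2 = y ^+ 2 /\ x ^+ 4 = 1].

Section Conjugation.
Context (G : groupType).
Implicit Types x y : G.

Lemma commuteE x y : commute x y <-> x ^ y = x.
Proof. by split=> [/commgP/conjg_fixP | /conjg_fixP/commgP]. Qed.

Lemma conj_inverseE x y : x ^ y = x^-1 ->
  [/\ x * y = y * x^-1, x^-1 * y = y * x,
      y^-1 * x = x^-1 * y^-1 & y^-1 * x^-1 = x * y^-1].
Proof.
move=> xy; have e1 : x * y = y * x^-1 by rewrite (conjgC x) xy.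
have e2 : x^-1 * y = y * x by rewrite (conjgC x^-1) conjVg xy invgK.
by split=> //; apply: (mulIg y); rewrite mulgVK -mulgA ?e1 ?e2 mulKg.
Qed.

Lemma conj_inverseV x y : x ^ y^-1 = x^-1 -> x ^ y = x^-1.
Proof. by move=> xy; apply: invg_inj; rewrite invgK -conjVg -xy conjgKV. Qed.

Lemma conj_inverse_sym x y : x ^ y = x^-1 -> y ^ x = y * x ^+ 2.
Proof. by case/conj_inverseE=> _ e _ _; rewrite conjgE mulgA e expg2 mulgA. Qed.

End Conjugation.

(** * Symmetric elements of the group algebra *)

Section CommutingElements.
Import GRing.Theory.

Lemma exprD_pchar_comm (R : nzRingType) p n (a b : R) :
    (p \in [pchar R] -> GRing.comm a b ->
  (a + b) ^+ (p ^ n) = a ^+ (p ^ n) + b ^+ (p ^ n))%R.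
Proof.
move=> charR; elim: n a b => [|n IH] a b ab; first by rewrite !expr1.
rewrite expnS !exprM -!(pFrobenius_autE charR) pFrobenius_autD_comm // IH //.
by rewrite !pFrobenius_autE; apply/commrX/commr_sym/commrX/commr_sym.
Qed.

Lemma comm_addrl (R : pzRingType) (c a b : R) :
  (GRing.comm c b -> GRing.comm (c + a) b -> GRing.comm a b)%R.
Proof.
move=> cb cab; apply/commr_sym; rewrite -[a](addKr c); apply: commrD.
  exact/commrN/commr_sym.
exact/commr_sym.
Qed.

End CommutingElements.

Section SymmetricElements.
Import GRing.Theory.
Local Open Scope ring_scope.
Context (K : comNzRingType) (G : groupType).
Local Notation KG := {group_algebra K[G]}.
Implicit Types (a b : KG) (x y g h : G) (k r : K).

Definition gmon k x : KG := << k *g x >>.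
Definition gtrace k x : KG := gmon k x + gmon k x^-1%g.

Lemma gmonM k r x y : gmon k x * gmon r y = gmon (k * r) (x * y)%g.
Proof. exact: gamulUU. Qed.

Lemma gmon1 : gmon 1 1%g = 1.
Proof. by []. Qed.

Lemma gmonD k r x : gmon (k + r) x = gmon k x + gmon r x.
Proof. exact: monalgUD. Qed.

Lemma gmonX x n : gmon 1 x ^+ n = gmon 1 (x ^+ n)%g.
Proof. by elim: n => // n IH; rewrite exprS IH gmonM mulr1 expgS. Qed.

Lemma gmon_nat n x : gmon 1 x *+ n = gmon n%:R x.
Proof. by rewrite /gmon -monalgUMn. Qed.

Lemma gastarw (d : {fset G}) a : (msupp a `<=` d)%fset ->
  gastar a = \sum_(x <- d) gmon a@_x x^-1%g.
Proof.
move=> le_d; rewrite /gastar (big_fset_incl _ le_d) //= => x _.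
by move/mcoeff_outdom => ->; rewrite monalgU0.
Qed.

Lemma gastarU k x : gastar (gmon k x) = gmon k x^-1%g.
Proof. by rewrite (gastarw msuppU_le) big_seq_fset1 mcoeffUU. Qed.

Lemma gastarD a b : gastar (a + b) = gastar a + gastar b :> KG.
Proof.
rewrite (gastarw (msuppD_le a b)) (gastarw (fsubsetUl (msupp a) (msupp b))).
rewrite (gastarw (fsubsetUr (msupp a) (msupp b))) -big_split /=.
by apply: eq_bigr => x _; rewrite -gmonD -mcoeffD.
Qed.

Lemma gastar0 : gastar (0 : KG) = 0 :> KG.
Proof. by rewrite /gastar msupp0 big_seq_fset0. Qed.

Lemma gastarN a : gastar (- a) = - gastar a :> KG.
Proof. by apply/eqP; rewrite -addr_eq0 -gastarD addNr gastar0. Qed.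

Lemma gastar_sum (I : Type) (s : seq I) (F : I -> KG) :
  gastar (\sum_(i <- s) F i) = \sum_(i <- s) (gastar (F i) : KG) :> KG.
Proof. exact: (big_morph (@gastar K G : KG -> KG) gastarD gastar0). Qed.

Lemma gsumE a : a = \sum_(x <- msupp a) gmon a@_x x.
Proof. exact: monalgE. Qed.

Lemma gastarM a b : gastar (a * b) = (gastar b : KG) * (gastar a : KG) :> KG.
Proof.
rewrite (gsumE a) (gsumE b) mulr_suml !gastar_sum mulr_sumr.
apply: eq_bigr => x _; rewrite mulr_sumr gastar_sum mulr_suml.
by apply: eq_bigr => y _; rewrite gmonM !gastarU gmonM invgM mulrC.
Qed.

Lemma gastar1 : gastar (1 : KG) = 1 :> KG.
Proof. by rewrite -gmon1 gastarU invg1. Qed.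

Lemma gastar_coef a x : (gastar a)@_x = a@_x^-1%g.
Proof.
rewrite {2}(gsumE a) [gastar a]/gastar !raddf_sum /=; apply: eq_bigr => y _.
rewrite !mcoeffU; congr (_ *+ _); congr nat_of_bool.
by apply/eqP/eqP => [<-|->]; rewrite invgK.
Qed.

Lemma gastar_trace k x : gastar (gtrace k x) = gtrace k x.
Proof. by rewrite gastarD !gastarU invgK addrC. Qed.

(** Subtracting from a symmetric element the part carried by {x, x^-1} keeps it
symmetric and shrinks its support; so the symmetric elements are spanned by
the involutions and the sums x + x^-1. *)
Lemma symmetric_ind (P : KG -> Prop) :
    P 0 -> (forall a b, P a -> P b -> P (a + b)) ->
    (forall k x, (x ^+ 2 = 1)%g -> P (gmon k x)) ->
    (forall k x, P (gtrace k x)) ->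
  forall a, gastar a = a -> P a.
Proof.
move=> P0 PD Pinv Ptr a; have [n] := ubnP #|` msupp a|%fset.
elim: n a => // n IH a le_an sym_a.
have [->//|a0] := eqVneq a 0.
have /fset0Pn [x xa] : msupp a != fset0.
  by apply: contra_neq a0 => s0; rewrite (gsumE a) s0 big_seq_fset0.
pose d : KG := if (x ^+ 2 == 1)%g then gmon a@_x x else gtrace a@_x x.
have [Pd sym_d] : P d /\ gastar d = d.
  rewrite /d; case: eqP => [x2|_]; split; rewrite ?gastar_trace //.
    exact: Pinv.
  rewrite gastarU; congr gmon.
  by apply: (mulgI x); rewrite mulgV -expg2.
rewrite -(subrK d a); apply: (PD) => //; apply: IH; last first.
  by rewrite gastarD gastarN sym_d sym_a.
have dx : d@_x = a@_x.
  rewrite /d; case: eqP => [_|x2]; first by rewrite mcoeffUU.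
  rewrite mcoeffD mcoeffUU mcoeffU; case: eqP => [xV|]; last by rewrite addr0.
  by case: x2; rewrite expg2 -{1}xV mulVg.
rewrite ltnS in le_an; apply: leq_trans le_an; apply: fproper_ltn_card.
apply/andP; split; last first.
  apply/fsubsetPn; exists x => //.
  by rewrite -mcoeff_neq0 mcoeffB dx subrr eqxx.
apply/fsubsetP => y; apply: contraLR => ya; rewrite -mcoeff_neq0 negbK mcoeffB.
have ay0 := mcoeff_outdom ya.
have yx : x == y = false by apply: contraNF ya => /eqP <-.
have yxV : x^-1%g == y = false.
  apply: contraNF ya => /eqP <-.
  by rewrite -mcoeff_neq0 -gastar_coef sym_a mcoeff_neq0.
rewrite ay0 /d; case: ifP => _; rewrite ?mcoeffD !mcoeffU ?yx ?yxV !mulr0n.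
  by rewrite subr0.
by rewrite addr0 subr0.
Qed.

(** The product of two symmetric units is symmetric, and its image under the
involution is the product in the other order. *)
Lemma symmetric_unit_comm a b :
  unit_subgroup (@symmetric_unit K G) ->
  symmetric_unit a -> symmetric_unit b -> a * b = b * a.
Proof.
case=> _ [_ mulS] _ Sa Sb; have /andP[_ /eqP] := mulS a b Sa Sb.
by case/andP: Sa => _ /eqP sa; case/andP: Sb => _ /eqP sb; rewrite gastarM sa sb.
Qed.

Lemma unit_subgroup_of_comm :
  (forall a b, gastar a = a -> gastar b = b -> a * b = b * a) ->
  unit_subgroup (@symmetric_unit K G).
Proof.
move=> symC; split.
- by move=> a /andP[].
- split; first by rewrite unfold_in /= /symmetric_unit unitr1 gastar1 eqxx.
  move=> a b /andP[Ua /eqP sa] /andP[Ub /eqP sb].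
  by rewrite unfold_in /= /symmetric_unit unitrMl // Ua gastarM sa sb symC ?eqxx.
- move=> a /andP[Ua /eqP sa]; rewrite unfold_in /= /symmetric_unit unitrV Ua /=.
  apply/eqP/(mulrI Ua); rewrite divrr //.
  by rewrite -{1}sa -gastarM mulVr // gastar1.
Qed.

(** In the first three cases of goodness, exchanging the factors permutes the four
products of x or x^-1 with y or y^-1; in the last case they cancel in pairs. *)
Lemma comm_of_good : 2%N \in [pchar K] -> good G ->
  forall a b, gastar a = a -> gastar b = b -> a * b = b * a.
Proof.
move=> char2 [invC goodG].
have twice k x : gmon k x + gmon k x = 0.
  by rewrite -gmonD -mulr2n -mulr_natr pcharf0 // mulr0 /gmon monalgU0.
have cancel k x y : gmon k x + gmon k y + (gmon k y + gmon k x) = 0.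
  by rewrite [X in _ + X]addrC addrACA !twice addr0.
have comm_inv k r x y : commute x y -> gmon k x * gmon r y = gmon r y * gmon k x.
  by move=> xy; rewrite !gmonM mulrC xy.
have expand k r x y : gtrace k x * gtrace r y =
    gmon (k * r) (x * y)%g + gmon (k * r) (x * y^-1)%g
    + (gmon (k * r) (x^-1 * y)%g + gmon (k * r) (x^-1 * y^-1)%g).
  by rewrite /gtrace mulrDl !mulrDr !gmonM.
have comm_trace k r x y : gtrace k x * gtrace r y = gtrace r y * gtrace k x.
  have [xy|xy|yx|[xy x4]] := goodG x y.
  - apply: commrD; apply/commr_sym/commrD; apply: comm_inv.
    + exact/commute_sym.
    + exact/commuteV/commute_sym.
    + exact/commute_sym/commuteV.
    + exact/commuteV/commute_sym/commuteV.
  - rewrite !expand [r * k]mulrC; have [-> -> -> ->] := conj_inverseE xy.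
    rewrite addrACA [X in X + _]addrC -!addrA; congr (_ + (_ + _)).
    exact: addrC.
  - rewrite !expand [r * k]mulrC; have [-> -> -> ->] := conj_inverseE yx.
    by rewrite [RHS]addrC [RHS]addrACA.
  - have sq (z : G) : (z ^+ 4 = 1 -> z ^+ 2 = z^-1 ^+ 2)%g.
      by move=> z4; apply: (mulgI (z ^+ 2)%g); rewrite -expgnDr z4 expVgn mulgV.
    have pair (z w : G) : (z ^+ 2 = w ^+ 2 -> z * w^-1 = z^-1 * w)%g.
      move=> zw; apply: (mulgI z); apply: (mulIg w).
      by rewrite !mulgA mulgVK mulgV mul1g -!expg2.
    have y4 : (y ^+ 4 = 1)%g by rewrite (expgnA y 2 2) -xy -expgnA.
    have e1 := pair _ _ xy.
    have e2 : (x * y = x^-1 * y^-1)%g.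
      by rewrite -{1}(invgK y); apply: pair; rewrite -(sq _ y4).
    have e3 := pair _ _ (esym xy).
    have e4 : (y * x = y^-1 * x^-1)%g.
      by rewrite -{1}(invgK x); apply: pair; rewrite -(sq _ x4).
    by rewrite !expand e1 e2 e3 e4 !cancel.
move=> a b sa sb; move: a sa; apply: symmetric_ind => [|a1 a2 c1 c2|k x x2|k x].
- by rewrite mul0r mulr0.
- by rewrite mulrDl c1 c2 -mulrDr.
- rewrite (gsumE b) mulr_suml mulr_sumr; apply: eq_bigr => y _.
  by apply: comm_inv; apply: invC.
- move: b sb; apply: symmetric_ind => [|b1 b2 c1 c2|r y y2|r y] //.
  + by rewrite mul0r mulr0.
  + by rewrite mulrDr c1 c2 -mulrDl.
  + by apply/commr_sym/commrD; apply: comm_inv; apply: invC.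
Qed.

(** An element that occurs once in the first sum has coefficient 1 there, hence
a nonzero coefficient in the second sum. *)
Lemma sum_gmon_mem (s1 s2 : seq G) z :
    \sum_(x <- s1) gmon 1 x = \sum_(x <- s2) gmon 1 x ->
  count_mem z s1 = 1%N -> z \in s2.
Proof.
have coef s : (\sum_(x <- s) gmon 1 x : KG)@_z = (count_mem z s)%:R.
  elim: s => [|x s IH]; first by rewrite big_nil mcoeff0.
  by rewrite big_cons mcoeffD IH /= natrD mcoeffU.
move=> e c1; rewrite -has_pred1 has_count lt0n.
have := coef s2; rewrite -e coef c1; case: (count_mem z s2) => // /eqP.
by rewrite oner_eq0.
Qed.

Lemma pchar_group_algebra p : p \in [pchar K] -> p \in [pchar KG].
Proof.
move=> /andP[pr_p /eqP p0]; apply/andP; split => //; apply/eqP.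
by rewrite -gmon1 gmon_nat p0 /gmon monalgU0.
Qed.

(** A power of c + x + x^-1 with exponent a power of p is c + 2, which is
invertible in characteristic p for a suitable c in {0, 1}. *)
Lemma trace_unit p x : p \in [pchar K] -> (exists n, x ^+ (p ^ n) = 1)%g ->
  ((p == 2)%:R + gtrace 1 x) \is a @GRing.unit KG.
Proof.
move=> /pchar_group_algebra charp [n xn]; have /andP[pr_p /eqP pKG] := charp.
have pn0 : (0 < p ^ n)%N by rewrite expn_gt0 prime_gt0.
rewrite -(unitrX_pos _ pn0) (exprD_pchar_comm n charp); last first.
  exact/commr_sym/commr_nat.
rewrite (exprD_pchar_comm n charp); last first.
  by rewrite /GRing.comm !gmonM mulgV mulVg.
rewrite !gmonX expVgn xn invg1 gmon1 -mulr2n.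
have -> : ((p == 2)%:R ^+ (p ^ n) : KG) = (p == 2)%:R.
  by case: (p == 2); rewrite ?expr1n // expr0n gtn_eqF.
case: eqP => [p2|/eqP p2]; first by rewrite p2 in pKG; rewrite pKG addr0 unitr1.
(* For odd p the inverse of 2 is (p + 1) / 2. *)
rewrite add0r; apply/unitrP; exists (p.+1./2)%:R.
have halfK : (p.+1./2 * 2 = p.+1)%N.
  by rewrite muln2 even_halfK //= negbK; case/even_prime: pr_p p2 => [->|].
by rewrite -!natrM (mulnC 2%N) halfK -natr1 pKG add0r.
Qed.

Lemma trace_symmetric_unit p x :
    p \in [pchar K] -> (exists n, x ^+ (p ^ n) = 1)%g ->
  symmetric_unit ((p == 2)%:R + gtrace 1 x).
Proof.
move=> charp px; apply/andP; split; first exact: trace_unit px.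
rewrite gastarD gastar_trace; case: (p == 2); last by rewrite gastar0.
by rewrite gastar1.
Qed.

Lemma involution_symmetric_unit x : (x ^+ 2 = 1)%g -> symmetric_unit (gmon 1 x).
Proof.
move=> x2; have xx : gmon 1 x * gmon 1 x = 1 by rewrite gmonM mulr1 -expg2 x2.
apply/andP; split; first by apply/unitrP; exists (gmon 1 x).
by rewrite gastarU; have /eqP := x2; rewrite expg2 mulg_eq1 => /eqP <-.
Qed.

Lemma trace_comm p x y : p \in [pchar K] -> is_p_group p G ->
    unit_subgroup (@symmetric_unit K G) ->
  gtrace 1 x * gtrace 1 y = gtrace 1 y * gtrace 1 x.
Proof.
move=> charp pG subS.
have Sc z := trace_symmetric_unit charp (pG z).
have nat_comm b : GRing.comm ((p == 2)%:R : KG) b.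
  by apply/commr_sym/commr_nat.
have e := comm_addrl (nat_comm _) (symmetric_unit_comm subS (Sc x) (Sc y)).
exact/commr_sym/(comm_addrl (nat_comm _))/commr_sym/e.
Qed.

Lemma trace_commE x y :
    gtrace 1 x * gtrace 1 y = gtrace 1 y * gtrace 1 x ->
  \sum_(z <- [:: x * y; x * y^-1; x^-1 * y; x^-1 * y^-1]%g) gmon 1 z =
  \sum_(z <- [:: y * x; y * x^-1; y^-1 * x; y^-1 * x^-1]%g) gmon 1 z.
Proof.
rewrite !big_cons !big_nil !addr0 /gtrace !mulrDl !mulrDr !gmonM !mulr1.
by rewrite -!addrA.
Qed.

End SymmetricElements.

Section GoodOfSymmetric.
Import GRing.Theory.
Context (K : comNzRingType) (G : groupType) (p : nat).
Hypothesis charp : (p \in [pchar K])%R.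
Hypothesis pG : is_p_group p G.
Hypothesis subS : unit_subgroup (@symmetric_unit K G).
Implicit Types x y : G.

(** Comparing the coefficients of xy in the two products of traces. *)
Lemma trace_comm_cases x y :
    x ^+ 2 <> 1 -> y ^+ 2 <> 1 -> x * y <> x^-1 * y^-1 ->
  [\/ commute x y, x ^ y = x^-1, y ^ x = y^-1 | (x * y) ^+ 2 = 1].
Proof.
move=> x2 y2 xy; have e := trace_commE (trace_comm x y charp pG subS).
have sq1 (z : G) : z = z^-1 -> z ^+ 2 = 1 by move=> e1; rewrite expg2 {2}e1 mulgV.
have := sum_gmon_mem (z := x * y) e; rewrite /= eqxx.
have -> : (x * y^-1 == x * y) = false.
  by apply/eqP => /mulgI/esym/sq1.
have -> : (x^-1 * y == x * y) = false.
  by apply/eqP => /mulIg/esym/sq1.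
have -> : (x^-1 * y^-1 == x * y) = false by apply/eqP => /esym.
move/(_ erefl); rewrite !inE => /or4P[] /eqP exy.
- exact: Or41.
- by apply: Or42; rewrite conjgE exy mulKg.
- by apply: Or43; apply: invg_inj; rewrite -conjVg invgK conjgE -exy mulKg.
- by apply: Or44; rewrite expg2 {2}exy -invgM mulgV.
Qed.

(** The coefficient of tx in the two products of t with the trace of x. *)
Lemma involution_comm_cases (t x : G) : t ^+ 2 = 1 -> x ^+ 2 <> 1 ->
  commute t x \/ (t * x) ^+ 2 = 1.
Proof.
move=> t2 x2; have St := involution_symmetric_unit K t2.
have nat_comm b : GRing.comm ((p == 2%N)%:R : {group_algebra K[G]})%R b.
  by apply/commr_sym/commr_nat.
have := symmetric_unit_comm subS (trace_symmetric_unit charp (pG x)) St.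
move/(comm_addrl (nat_comm _)).
rewrite /GRing.comm mulrDl mulrDr !gmonM !mulr1 => e.
have e' : (\sum_(z <- [:: t * x; t * x^-1]%g) gmon 1 z =
  \sum_(z <- [:: x * t; x^-1 * t]%g) (gmon 1 z : {group_algebra K[G]}))%R.
  by rewrite !big_cons !big_nil !addr0.
have := sum_gmon_mem (z := t * x) e'; rewrite /= eqxx.
have -> : (t * x^-1 == t * x) = false.
  by apply/eqP => /mulgI xV; case: x2; rewrite expg2 -{1}xV mulVg.
move/(_ erefl); rewrite !inE => /orP[] /eqP tx; [by left | right].
by rewrite expg2 {2}tx mulgA mulgK -expg2.
Qed.

Lemma commute_involutions (t u : G) : t ^+ 2 = 1 -> u ^+ 2 = 1 -> commute t u.
Proof.
move=> t2 u2; have := symmetric_unit_comm subS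
  (involution_symmetric_unit K t2) (involution_symmetric_unit K u2).
rewrite !gmonM mulr1 => e.
have e' : (\sum_(z <- [:: t * u]%g) gmon 1 z =
  \sum_(z <- [:: u * t]%g) (gmon 1 z : {group_algebra K[G]}))%R.
  by rewrite !big_cons !big_nil !addr0.
have := sum_gmon_mem (z := t * u) e'.
by rewrite /= eqxx inE => /(_ erefl)/eqP.
Qed.

(** If t and tx are involutions, they commute, and then so do t and x. *)
Lemma commute_involution (t x : G) : t ^+ 2 = 1 -> commute t x.
Proof.
move=> t2; have [/eqP|/eqP x2] := eqVneq (x ^+ 2) 1.
  by move/eqP; apply: commute_involutions.
have [//|tx2] := involution_comm_cases t2 x2.
have := commute_involutions t2 tx2.
by rewrite /commute -mulgA => /mulgI.
Qed.

(** The coefficient of xy is informative unless x^2 = y^-2, that of xy^-1 unless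
x^2 = y^2; when both fail, x^2 = y^2 has order at most 2. *)
Lemma good_of_symmetric : good G.
Proof.
split=> [t x|x y]; first exact: commute_involution.
have [/commute_involution xC|/eqP x2] := eqVneq (x ^+ 2) 1; first exact: Or41.
have [/commute_involution yC|/eqP y2] := eqVneq (y ^+ 2) 1.
  exact/Or41/commute_sym.
have commM (u v : G) : (u * v) ^+ 2 = 1 -> commute u v.
  move=> /(@commute_involution _ u); rewrite /commute -mulgA => /mulgI.
  exact: esym.
have [exy|/eqP nxy] := eqVneq (x * y) (x^-1 * y^-1); last first.
  have [? | ? | ? | /commM ?] := trace_comm_cases x2 y2 nxy.
  - exact: Or41.
  - exact: Or42.
  - exact: Or43.
  - exact: Or41.
have y2V : y^-1 ^+ 2 <> 1.
  by rewrite expVgn => /eqP; rewrite invg_eq1 => /eqP.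
have [exyV|/eqP nxy] := eqVneq (x * y^-1) (x^-1 * y); last first.
  rewrite -{2}[y]invgK in nxy.
  have [xy | xy | yx | /commM xy] := trace_comm_cases x2 y2V nxy.
  - by apply: Or41; rewrite -[y]invgK; apply: commuteV.
  - by apply: Or42; apply: conj_inverseV.
  - by apply: Or43; apply: invg_inj; rewrite -conjVg.
  - by apply: Or41; rewrite -[y]invgK; apply: commuteV.
have e1 : x ^+ 2 = y ^+ 2.
  by apply: (mulgI x^-1); apply: (mulIg y^-1); rewrite !expg2 mulKg mulgA mulgK.
apply: Or44; split=> //.
have e2 : x ^+ 2 = y ^- 2.
  apply: (mulgI x^-1); apply: (mulIg y).
  by rewrite !expg2 mulKg invgM mulgA mulgVK.
by rewrite (expgnDr x 2 2) {1}e2 e1 mulVg.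
Qed.

End GoodOfSymmetric.

Section OddCharacteristic.
Context (K : comNzRingType) (G : groupType) (p : nat).
Hypothesis charp : (p \in [pchar K])%R.
Hypothesis pG : is_p_group p G.
Hypothesis odd_p : odd p.
Implicit Types x y : G.

Lemma sqrt_in_odd_group x y : exists n, x = (x ^+ 2) ^+ n /\ y = (y ^+ 2) ^+ n.
Proof.
have [a xa] := pG x; have [b yb] := pG y.
have odd_pn : odd (p ^ (a + b)) by rewrite oddX odd_p orbT.
(* The exponent is an inverse of 2 modulo a multiple of both orders. *)
exists (p ^ (a + b)).+1./2; rewrite -!expgnA mul2n even_halfK ?oddS ?odd_pn //.
by rewrite !expgS {1}expnD addnC expnD !expgnA xa yb !expg1n !mulg1.
Qed.

Lemma sqrg_inj x y : x ^+ 2 = y ^+ 2 -> x = y.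
Proof.
by have [n [ex ey]] := sqrt_in_odd_group x y => e; rewrite [LHS]ex e -ey.
Qed.

Lemma commute_of_sqrg x y : commute x (y ^+ 2) -> commute x y.
Proof.
by have [n [_ ey]] := sqrt_in_odd_group y y => xy; rewrite ey; apply: commuteX.
Qed.

Lemma commute_of_inverted x y : x ^ y = x^-1 -> commute x y.
Proof.
move=> xy; apply: commute_of_sqrg; rewrite /commute conjgC expg2 conjgM xy.
by rewrite conjVg xy invgK.
Qed.

(** In a group without involutions the coefficient of xy in the product of the
traces of x and y is 1, which leaves only xy = yx. *)
Lemma commutative_of_symmetric :
  unit_subgroup (@symmetric_unit K G) -> commutative_group G.
Proof.
move=> subS x y; rewrite -/(commute x y).
have sq1 (z : G) : z ^+ 2 = 1 -> z = 1.
  by move=> z2; apply: sqrg_inj; rewrite z2 expg1n.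
have [/sq1 ->|/eqP x2] := eqVneq (x ^+ 2) 1.
  exact/commute_sym/commute1.
have [/sq1 ->|/eqP y2] := eqVneq (y ^+ 2) 1; first exact/commute1.
have [e|/eqP exy] := eqVneq (x * y) (x^-1 * y^-1).
  have /sqrg_inj -> : x ^+ 2 = y^-1 ^+ 2.
    apply: (mulgI x^-1); apply: (mulIg y).
    by rewrite !expg2 mulKg mulgA mulgVK.
  exact/commute_sym/commuteV.
have [//|||] := trace_comm_cases charp pG subS x2 y2 exy.
- exact: commute_of_inverted.
- by move/commute_of_inverted/commute_sym.
- move/sq1 => /mulg1_eq <-; exact: commuteV.
Qed.

End OddCharacteristic.

(** * Elements of order greater than four *)

Section InvertedSubgroup.
Context (G : groupType).
Implicit Types x y u w : G.

(** The abelian subgroup is the centralizer of w: inversion is multiplicative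
on it. *)
Lemma inverted_centralizer w u :
    u ^+ 4 = 1 -> u ^+ 2 <> 1 -> ~ commute w u ->
    (forall x, commute w x \/ commute w (u^-1 * x)) ->
    (forall x, commute w x -> x ^ u = x^-1) ->
  inverted_by_order4 G.
Proof.
move=> u4 u2 wu cover invert; exists (fun x => w * x == x * w), u.
have memP x :
    reflect (commute w x) (x \in ((fun x => w * x == x * w) : {pred G})).
  exact: eqP.
have closed : group_closed (fun x => w * x == x * w).
  split; first exact/memP/commute1.
  by move=> x y /memP wx /memP wy; apply/memP/commuteM/commuteV.
split=> //.
- move=> x y /memP wx /memP wy; apply: invg_inj.
  rewrite [RHS]invgM -(invert x) // -(invert y) // -conjMg invert //.
  exact: commuteM.
- exists u; first exact/memP.
  by move=> x; have [/memP|/memP] := cover x; [left | right].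
- split=> // m m4 um; apply: u2.
  case: m m4 um => [|[|[|[|]]]] // _ um; first by rewrite (um : u = 1) expg1n.
  suff -> : u = 1 by rewrite expg1n.
  by rewrite -u4 (expgSr _ 3) um mul1g.
- by move=> x /memP; apply: invert.
Qed.

End InvertedSubgroup.

Section LargeOrder.
Context (G : groupType).
Hypothesis goodG : good G.
Implicit Types x y g b c u w : G.

(** If g inverted b but b did not invert g, the pair (gb, g) would not be good. *)
Lemma large_order_inverted g b : g ^+ 4 <> 1 -> ~ commute g b -> g ^ b = g^-1.
Proof.
case: goodG => _ goodP g4 gb; have [//|//|bg|[_ //]] := goodP g b.
have [|||] := goodP (g * b) g.
- by rewrite /commute -mulgA => /mulgI/esym.
- rewrite conjMg bg [g ^ g]conjgE mulKg invgM => e; apply: conj_inverseV.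
  by rewrite conjgE invgK e mulVKg.
- by rewrite conjgM [g ^ g]conjgE mulKg.
- case=> e2 e4; case: g4; move: e4.
  by rewrite (expgnA _ 2 2) e2 -expgnA.
Qed.

(** If b does not invert c, it does not invert gc either. When c^4 = 1 the order
of gc exceeds 4, so b commutes with gc, and then (c, b) is not a good pair.
Otherwise b commutes with c, and (gc, b) is not a good pair: each of its
remaining cases would make b commute with g^2. *)
Lemma centralizer_inverted g b c : g ^+ 4 <> 1 -> g ^ b = g^-1 ->
  commute g c -> c ^ b = c^-1.
Proof.
case: (goodG) => _ goodP g4 gb gc; apply: contrapT => nc.
have g2b : ~ commute (g ^+ 2) b.
  move/commuteE; rewrite conjXg gb expVgn => e; case: g4.
  by rewrite (expgnDr g 2 2) -{1}e mulVg.
have g2 : g ^+ 2 <> 1.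
  by move=> e; apply: g2b; rewrite e; apply/commute_sym/commute1.
have gcb : (g * c) ^ b = g^-1 * c ^ b by rewrite conjMg gb.
have gc_inv : (g * c) ^ b <> (g * c)^-1.
  by rewrite gcb gc invgM => /mulgI.
have c_large : c ^+ 4 <> 1 -> commute c b.
  by move=> c4; apply: contrapT => /(large_order_inverted c4).
have [c4|/eqP/[dup] c4 /c_large cb] := eqVneq (c ^+ 4) 1.
  have gc4 : (g * c) ^+ 4 <> 1 by rewrite expgMn // c4 mulg1.
  have : commute (g * c) b.
    by apply: contrapT => /(large_order_inverted gc4).
  move/commuteE; rewrite gcb => e.
  have {}e : c ^ b = g ^+ 2 * c.
    by apply: (mulgI g^-1); rewrite e expg2 -mulgA mulKg.
  have [/commuteE|//|/conj_inverse_sym|[cb _]] := goodP c b.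
  - by rewrite e -{2}[c]mul1g => /mulIg.
  - rewrite e -(commuteX 2 (commute_sym gc)) => /mulgI e2; apply: g2b.
    by rewrite e2; apply/commute_sym/commuteX.
  - case: g4; apply: (mulIg (c ^+ 2)); rewrite mul1g.
    rewrite (expgnA g 2 2) -expgMn; last exact/commute_sym/commuteX/commute_sym.
    by rewrite -e -conjXg cb conjXg [b ^ b]conjgE mulKg.
have [/commuteE|//| bgc |[e _]] := goodP (g * c) b.
- rewrite gcb; have /commuteE -> := cb => /mulIg e.
  by apply: g2; rewrite expg2 -{1}e mulVg.
- have /conj_inverse_sym : b ^ g = b^-1.
    apply: (conjg_inj c); rewrite -conjgM bgc conjVg; congr _^-1.
    exact/esym/commuteE/commute_sym.
  rewrite gb => e; apply: g2b; apply/commute_sym.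
  have -> : g ^+ 2 = b ^- 2.
    apply: invg_inj; rewrite invgK; apply: (mulgI g).
    by rewrite -e expg2 invgM mulVKg.
  exact/commuteV/commuteX.
- apply: g2b; apply/commute_sym.
  have -> : g ^+ 2 = b ^+ 2 * c ^- 2.
    by rewrite -e expgMn // mulgK.
  by apply: commuteM; [apply: commuteX | apply/commuteV/commuteX/commute_sym].
Qed.

Lemma good_large_order g b :
  g ^+ 4 <> 1 -> ~ commute g b -> inverted_by_order4 G.
Proof.
move=> g4 gb; have inv_g := large_order_inverted g4; have g_b := inv_g _ gb.
have invC := centralizer_inverted g4 g_b.
have gb2 : commute g (b ^+ 2).
  by apply/commuteE; rewrite expg2 conjgM g_b conjVg g_b invgK.
apply: (@inverted_centralizer _ g b) => // [|b2|x].
- rewrite (expgnDr b 2 2); have := invC _ gb2.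
  by rewrite conjXg [b ^ b]conjgE mulKg => {1}->; rewrite mulVg.
- by apply: gb; apply: commute_sym; case: goodG => invG _; apply: invG.
- have [|gx] := pselect (commute g x); [by left | right].
  apply/commuteE; rewrite conjgM.
  have -> : g ^ b^-1 = g^-1 by apply: conj_inverseV; rewrite invgK.
  by rewrite conjVg inv_g // invgK.
Qed.

(** Multiplying by a central element of order greater than 4 turns an element of
order at most 4 into one of order greater than 4. *)
Lemma good_small_order :
  ~ commutative_group G -> ~ inverted_by_order4 G -> forall x, x ^+ 4 = 1.
Proof.
move=> nabG ninv z; apply: contrapT => z4.
have small x y : x ^+ 4 <> 1 -> commute x y.
  by move=> x4; apply: contrapT => /(good_large_order x4).
apply: nabG => g h; apply: contrapT => gh; have zC x := small z x z4.
have g4 : g ^+ 4 = 1 by apply: contrapT => /(small _ h).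
have : commute (z * g) h.
  by apply: small; rewrite expgMn // g4 mulg1.
by rewrite /commute mulgA -(zC h) -!mulgA => /mulgI.
Qed.

End LargeOrder.

(** * Good groups of exponent four *)

(** Squares and commutators are central of order at most 2, so the commutator is
bimultiplicative and symmetric: it is the polar form of the squaring map. *)
Section ExponentFour.
Context (G : groupType).
Hypothesis invC : involutions_central G.
Hypothesis exp4 : forall x : G, x ^+ 4 = 1.
Implicit Types x y z u w : G.

Lemma sqr_sqr x : (x ^+ 2) ^+ 2 = 1.
Proof. by rewrite -expgnA exp4. Qed.

Lemma commute_sqr x y : commute (x ^+ 2) y.
Proof. by apply: invC; apply: sqr_sqr. Qed.

Lemma involution_mul x y : x ^+ 2 = 1 -> y ^+ 2 = 1 -> (x * y) ^+ 2 = 1.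
Proof. by move=> x2 y2; rewrite expgMn ?x2 ?y2 ?mulg1 //; apply: invC. Qed.

Lemma involutionV x : x ^+ 2 = 1 -> x^-1 = x.
Proof. by move=> x2; apply: mulg1_eq; rewrite -expg2. Qed.

Lemma commgE_sqr x y : [~ x, y] = (x^-1 * y^-1) ^+ 2 * (x ^+ 2 * y ^+ 2).
Proof.
have -> : x ^+ 2 * y ^+ 2 = y * x * (x * y).
  by rewrite [y ^+ 2]expg2 mulgA (commute_sqr x y) expg2 !mulgA.
by rewrite expg2 -invgM -[RHS]mulgA mulKg invgM /commg /conjg !mulgA.
Qed.

Lemma commg_sqr x y : [~ x, y] ^+ 2 = 1.
Proof.
by rewrite commgE_sqr; do 2! [apply: involution_mul; try exact: sqr_sqr].
Qed.

Lemma commute_commg x y z : commute [~ x, y] z.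
Proof. by apply: invC; apply: commg_sqr. Qed.

Lemma commgC_sym x y : [~ x, y] = [~ y, x].
Proof. by rewrite -invgR involutionV ?commg_sqr. Qed.

Lemma commgM_r x y z : [~ x, y * z] = [~ x, y] * [~ x, z].
Proof.
rewrite [LHS]/commg conjgM -[x ^ y](mulVKg x) conjMg mulgA -/(commg x y).
rewrite (_ : [~ x, y] ^ z = [~ x, y]); first exact: commute_commg.
exact/commuteE/commute_commg.
Qed.

Lemma commgM_l x y z : [~ x * y, z] = [~ x, z] * [~ y, z].
Proof. by rewrite commgC_sym commgM_r !(commgC_sym z). Qed.

Lemma sqrM x y : (x * y) ^+ 2 = x ^+ 2 * y ^+ 2 * [~ x, y].
Proof.
rewrite !expg2 -(mulgA x y) [y * (x * y)]mulgA (commgC y x) (commgC_sym y x).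
have := commute_commg x y y; rewrite /commute; move: [~ x, y] => k ky.
by rewrite -!mulgA ky.
Qed.

Lemma commg_sqrE x y : [~ x, y] = x ^+ 2 * y ^+ 2 * (x * y) ^+ 2.
Proof.
by rewrite sqrM mulgA -expg2 involution_mul ?sqr_sqr ?mul1g.
Qed.

Lemma conj_inverse4 x y : [~ x, y] = x ^+ 2 -> x ^ y = x^-1.
Proof.
move=> xy; rewrite -[x ^ y](mulVKg x) -/(commg x y) xy -expgS.
by apply/esym/mulg1_eq; rewrite -expgS.
Qed.

Lemma commg_of_inverse x y : x ^ y = x^-1 -> [~ x, y] = x ^+ 2.
Proof.
by move=> xy; rewrite /commg xy -invgM -expg2 involutionV ?sqr_sqr.
Qed.

(** The second alternative puts ux in the centralizer of w, so the centralizer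
has index 2 and u inverts it. *)
Lemma inverted_of_cover w u :
    u ^+ 2 <> 1 -> [~ w, u] <> 1 ->
    (forall x, ([~ w, x] = 1 /\ [~ u, x] = x ^+ 2) \/
               ([~ w, u * x] = 1 /\ [~ u, u * x] = (u * x) ^+ 2)) ->
  inverted_by_order4 G.
Proof.
move=> u2 wu cover.
apply: (@inverted_centralizer _ w u) => // [/commgP/eqP //|x|x].
- have [[/eqP/commgP wx _]|[/eqP/commgP wux _]] := cover x; [by left | right].
  have -> : u^-1 * x = (u ^+ 2) * (u * x).
    apply: (mulgI u); have := exp4 u.
    by rewrite !expgS expg0 mulg1 mulVKg !mulgA => ->; rewrite mul1g.
  exact/commuteM/wux/commute_sym/commute_sqr.
- move=> /commgP/eqP wx; apply: conj_inverse4.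
  have [[_ <-]|[]] := cover x; first exact: commgC_sym.
  by rewrite commgM_r wx mulg1.
Qed.

End ExponentFour.

(** * Squares that span more than two dimensions *)

Lemma mulgACA (G : groupType) (x y x' y' : G) :
  commute y x' -> x * y * (x' * y') = x * x' * (y * y').
Proof. by move=> yx'; rewrite -!mulgA (mulgA y) yx' -mulgA. Qed.

Section ThreeInvolutions.
Context (G : groupType).
Hypothesis invC : involutions_central G.
Variables s t r : G.
Hypotheses (s2 : s ^+ 2 = 1) (t2 : t ^+ 2 = 1) (r2 : r ^+ 2 = 1).
Implicit Types (x y z : G) (e f : bool * bool * bool).

Definition xor3 e f := (e.1.1 (+) f.1.1, e.1.2 (+) f.1.2, e.2 (+) f.2).
Definition word3 e := s ^+ e.1.1 * t ^+ e.1.2 * r ^+ e.2.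
Definition span2 x := exists a b : bool, x = s ^+ a * t ^+ b.

Lemma involution_expb z (a b : bool) :
  z ^+ 2 = 1 -> z ^+ a * z ^+ b = z ^+ (a (+) b).
Proof. by case: a; case: b => // z2; rewrite ?mul1g ?mulg1. Qed.

Lemma involution_expb2 z (a : bool) : z ^+ 2 = 1 -> (z ^+ a) ^+ 2 = 1.
Proof. by case: a => //; rewrite expg1n. Qed.

Lemma word3M e f : word3 e * word3 f = word3 (xor3 e f).
Proof.
have C x (b : bool) : x ^+ 2 = 1 -> forall y, commute (x ^+ b) y.
  by move=> x2 y; apply/invC/involution_expb2.
rewrite /word3 /=; rewrite mulgACA; last exact: C.
by rewrite [X in X * _ = _]mulgACA; [rewrite !involution_expb | apply: C].
Qed.

Lemma span2M x y : span2 x -> span2 y -> span2 (x * y).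
Proof.
case=> a [b ->] [a' [b' ->]]; exists (a (+) a'), (b (+) b').
rewrite mulgACA; last exact/invC/involution_expb2.
by rewrite !involution_expb.
Qed.

Lemma word3K e : word3 e * word3 e = 1.
Proof.
by rewrite word3M /xor3 !addbb /word3 /= !mulg1.
Qed.

Hypothesis s_neq1 : s <> 1.
Hypothesis t_neq1 : t <> 1.
Hypothesis s_neq_t : s <> t.
Hypothesis r_out : ~ span2 r.

(** The three involutions are independent, so equations between their products
are decided by exponents. *)
Lemma word3_inj : injective word3.
Proof.
have ker e : word3 e = 1 -> e = (false, false, false).
  case: e => [[a b] []]; rewrite /word3 /= => e; last first.
    move: e; rewrite mulg1; case: a; case: b => // e.
    - by case: s_neq_t; apply: (mulIg t); rewrite [LHS]e -expg2.
    - by case: s_neq1; rewrite -[LHS]mulg1.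
    - by case: t_neq1; rewrite -[LHS]mul1g.
  case: r_out; exists a, b; rewrite -[RHS]mulg1.
  by rewrite -{1}r2 expg2 mulgA e mul1g.
move=> e f ef; have : word3 (xor3 e f) = 1 by rewrite -word3M ef word3K.
case: e f {ef} => [[a b] c] [[a' b'] c'] /ker [].
have addbF (x y : bool) : x (+) y = false -> x = y by case: x; case: y.
by move=> /addbF -> /addbF -> /addbF ->.
Qed.

End ThreeInvolutions.

Section LargeSquareSpan.
Context (G : groupType).
Hypothesis goodG : good G.
Hypothesis exp4 : forall x : G, x ^+ 4 = 1.
Implicit Types x y z : G.
Let invC : involutions_central G := proj1 goodG.

Lemma good_commg x y :
  [\/ [~ x, y] = 1, [~ x, y] = x ^+ 2, [~ x, y] = y ^+ 2 | x ^+ 2 = y ^+ 2].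
Proof.
have [xy|xy|yx|[xy _]] := goodG.2 x y.
- by apply: Or41; apply/eqP/commgP.
- by apply: Or42; apply: commg_of_inverse.
- by apply: Or43; rewrite commgC_sym //; apply: commg_of_inverse.
- exact: Or44.
Qed.

Variables u w : G.
Let s := u ^+ 2.
Let t := w ^+ 2.
Hypothesis s_neq1 : s <> 1.
Hypothesis t_neq1 : t <> 1.
Hypothesis s_neq_t : s <> t.
Hypothesis uw : [~ u, w] = t.

Let s2 : s ^+ 2 = 1 := sqr_sqr exp4 u.
Let t2 : t ^+ 2 = 1 := sqr_sqr exp4 w.

Let sqr_uw : (u * w) ^+ 2 = s.
Proof. by rewrite sqrM // uw -mulgA -expg2 t2 mulg1. Qed.

Definition inverted_by_u x := [~ w, x] = 1 /\ [~ u, x] = x ^+ 2.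

(** The pairs (u, x), (w, x), (uw, x), (xu, uw) and (xuw, u) leave no other
possibility for the two commutators, as a computation in the group of order
8 spanned by the squares of u, w and x shows. *)
Lemma outside_inverted x : ~ span2 s t (x ^+ 2) -> inverted_by_u x.
Proof.
move=> r_out; set r := x ^+ 2 in r_out.
have r2 : r ^+ 2 = 1 := sqr_sqr exp4 x.
pose E := word3 s t r.
have EM e f : E e * E f = E (xor3 e f) by apply: word3M.
have inj : injective E by apply: word3_inj.
have E0 : 1 = E (false, false, false) by rewrite /E /word3 /= !mulg1.
have Es : s = E (true, false, false) by rewrite /E /word3 /= !mulg1.
have Et : t = E (false, true, false) by rewrite /E /word3 /= mul1g mulg1.
have Er : r = E (false, false, true) by rewrite /E /word3 /= !mul1g.
have goodE y z k q1 q2 : [~ y, z] = E k -> y ^+ 2 = E q1 -> z ^+ 2 = E q2 ->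
    [|| k == (false, false, false), k == q1, k == q2 | q1 == q2].
  move=> yz y2 z2; have := good_commg y z; rewrite yz y2 z2 E0.
  by case=> /inj ->; rewrite eqxx ?orbT.
have exE y z q1 q2 : y ^+ 2 = E q1 -> z ^+ 2 = E q2 -> q1 != q2 ->
    exists k, [~ y, z] = E k.
  move=> y2 z2 q12; have [->|->|->|e] := good_commg y z.
  - by eexists; exact: E0.
  - by exists q1.
  - by exists q2.
  - by case/eqP: q12; apply: inj; rewrite -y2 -z2.
have [k1 ux] := exE u x _ _ Es Er isT; have [k2 wx] := exE w x _ _ Et Er isT.
have G1 := goodE _ _ _ _ _ ux Es Er; have G2 := goodE _ _ _ _ _ wx Et Er.
have uwx : [~ u * w, x] = E (xor3 k1 k2) by rewrite commgM_l // ux wx EM.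
have G3 := goodE _ _ _ _ _ uwx (etrans sqr_uw Es) Er.
have xu2 : (x * u) ^+ 2 =
    E (xor3 (xor3 (false, false, true) (true, false, false)) k1).
  by rewrite sqrM // (commgC_sym invC exp4 x u) ux -!EM -Er -Es.
have xuw2 : (x * (u * w)) ^+ 2 =
    E (xor3 (xor3 (false, false, true) (true, false, false)) (xor3 k1 k2)).
  by rewrite sqrM // (commgC_sym invC exp4 x) uwx sqr_uw -!EM -Er -Es.
have xu_uw : [~ x * u, u * w] = E (xor3 (xor3 k1 k2) (false, true, false)).
  rewrite commgM_l // (commgC_sym invC exp4 x) uwx commgM_r // commgg mul1g uw.
  by rewrite -[E (xor3 (xor3 k1 k2) _)]EM -Et.
have xuw_u : [~ x * (u * w), u] = E (xor3 k1 (false, true, false)).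
  rewrite commgM_l // (commgC_sym invC exp4 x) ux commgM_l // commgg mul1g.
  by rewrite (commgC_sym invC exp4 w) uw -EM -Et.
have G4 := goodE _ _ _ _ _ xu_uw xu2 (etrans sqr_uw Es).
have G5 := goodE _ _ _ _ _ xuw_u xuw2 Es.
suff [k1E k2E] : k1 = (false, false, true) /\ k2 = (false, false, false).
  by split; rewrite ?wx ?ux ?k1E ?k2E -?Er -?E0.
move: G1 G2 G3 G4 G5; clear.
by case: k1 => [[[] []] []]; case: k2 => [[[] []] []].
Qed.

Let S := span2 s t.

Let SM a b : S a -> S b -> S (a * b).
Proof. exact: span2M. Qed.

Let S_cancel a b : a ^+ 2 = 1 -> S a -> S (a * b) -> S b.
Proof.
by move=> a2 Sa /(SM Sa); rewrite mulgA -expg2 a2 mul1g.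
Qed.

Let S1 : S 1. Proof. by exists false, false; rewrite mulg1. Qed.
Let Ss : S s. Proof. by exists true, false; rewrite mulg1. Qed.

Variable y : G.
Hypothesis y_out : ~ S (y ^+ 2).

Let inv_y : inverted_by_u y := outside_inverted y_out.

(** If x commutes with y and its square is in S, the square of xy is not. *)
Lemma commuting_inverted x : [~ x, y] = 1 -> inverted_by_u x.
Proof.
move=> xy; have [xS|] := pselect (S (x ^+ 2)); last exact: outside_inverted.
have xy2 : (x * y) ^+ 2 = x ^+ 2 * y ^+ 2 by rewrite sqrM // xy mulg1.
have [] : inverted_by_u (x * y).
  apply: outside_inverted; rewrite xy2 => /(S_cancel (sqr_sqr exp4 x) xS).
  exact: y_out.
case: inv_y => wy uy; rewrite !commgM_r // wy uy xy2 mulg1 => wx /mulIg ux.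
by split.
Qed.

(** If x does not commute with y then either ux does, or the square of xy is
that of y. *)
Lemma large_square_span_inverted : inverted_by_order4 G.
Proof.
apply: (@inverted_of_cover _ invC exp4 w u) => // [|x].
  by rewrite (commgC_sym invC exp4) uw.
rewrite -/(inverted_by_u x) -/(inverted_by_u (u * x)).
have [xS|] := pselect (S (x ^+ 2)); last by left; apply: outside_inverted.
have y2_neq a : S a -> y ^+ 2 <> a by move=> Sa e; apply: y_out; rewrite e.
case: (inv_y) => wy uy.
have [xy|xy|xy|xy] := good_commg x y.
- by left; apply: commuting_inverted.
- have [x2|/eqP x2] := eqVneq (x ^+ 2) 1.
    by left; apply: commuting_inverted; rewrite xy.
  (* Here xy has its square outside S, and then (ux, y) is not a good pair. *)
  have xy2 : (x * y) ^+ 2 = y ^+ 2.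
    rewrite sqrM // xy (commute_sqr invC exp4 x) -mulgA -expg2.
    by rewrite sqr_sqr // mulg1.
  have [_] : inverted_by_u (x * y) by apply: outside_inverted; rewrite xy2.
  rewrite commgM_r // uy xy2 -[RHS]mul1g => /mulIg ux.
  have ux_y : [~ u * x, y] = y ^+ 2 * x ^+ 2 by rewrite commgM_l // uy xy.
  have ux2 : (u * x) ^+ 2 = s * x ^+ 2 by rewrite sqrM // ux mulg1.
  have [] := good_commg (u * x) y; rewrite ?ux_y ?ux2.
  + by move/mulg1_eq; rewrite involutionV ?sqr_sqr // => /y2_neq[].
  + by move/mulIg/y2_neq; case.
  + by rewrite -[RHS]mulg1 => /mulgI.
  + by move/esym/y2_neq; case; apply: SM.
- have uxy : [~ u * x, y] = 1 by rewrite commgM_l // uy xy -expg2 sqr_sqr.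
  by right; apply: commuting_inverted.
- by case: (y2_neq _ xS).
Qed.

End LargeSquareSpan.

Section Hamiltonian.
Context (G : groupType).
Hypothesis goodG : good G.
Hypothesis exp4 : forall x : G, x ^+ 4 = 1.
Implicit Types x y z u w : G.
Let invC : involutions_central G := proj1 goodG.

(** Either some u inverts some w of order 4 with a different square, or any two
elements that do not commute have the same square, equal to their commutator;
in the second case G is inverted as the product of a quaternion group of
order 8 with an elementary abelian group. *)
Lemma unequal_squares_or_inverted : ~ commutative_group G ->
  inverted_by_order4 G \/ exists u w, [~ u, w] = w ^+ 2 /\
    [/\ u ^+ 2 <> 1, w ^+ 2 <> 1 & u ^+ 2 <> w ^+ 2].
Proof.
move=> nabG; set P := (X in _ \/ X); have [|nP] := pselect P; [by right | left].
have sqr_neq1 x y : [~ x, y] <> 1 -> x ^+ 2 <> 1.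
  by move=> xy x2; apply: xy; apply/eqP/commgP/invC.
have symR := commgC_sym invC exp4.
have inv_eq x y : [~ x, y] <> 1 -> [~ x, y] = y ^+ 2 -> x ^+ 2 = y ^+ 2.
  move=> nxy xy; apply: contrapT => x2y2; case: nP; exists x, y; split=> //.
  by split=> //; [apply: sqr_neq1 nxy | rewrite -xy].
have sq x y : [~ x, y] <> 1 -> x ^+ 2 = y ^+ 2.
  move=> nxy; have [//|xy|xy|//] := good_commg goodG exp4 x y; last exact: inv_eq.
  by apply/esym/inv_eq; rewrite symR.
have ham x y : [~ x, y] <> 1 -> [~ x, y] = x ^+ 2.
  move=> nxy; have xxy : [~ x, x * y] = [~ x, y].
    by rewrite commgM_r // commgg mul1g.
  rewrite (commg_sqrE invC exp4) -(sq x y nxy) -expg2 sqr_sqr // mul1g.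
  by rewrite -(sq x (x * y)) // xxy.
have [u [v uv]] : exists u v, [~ u, v] <> 1.
  apply: contrapT => ab; apply: nabG => x y; apply/commgP/eqP.
  by apply: contrapT => xy; apply: ab; exists x, y.
have vu : [~ v, u] <> 1 by rewrite symR.
have inv_cent x : [~ u, x] = 1 -> [~ v, x] = x ^+ 2.
  move=> ux; have [vx|/eqP] := eqVneq [~ v, x] 1; last first.
    by move=> vx; rewrite symR ham // symR.
  have := sq (u * x) v; rewrite commgM_l // (symR x) vx mulg1 => /(_ uv).
  by rewrite sqrM // ux mulg1 (sq u v uv) -[RHS]mulg1 => /mulgI ->.
apply: (@inverted_of_cover _ invC exp4 u v) => // [|x].
  exact: sqr_neq1 vu.
have [ux|/eqP ux] := eqVneq [~ u, x] 1; [left | right].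
  by split=> //; apply: inv_cent.
have uvx : [~ u, v * x] = 1.
  by rewrite commgM_r // (ham _ _ uv) (ham _ _ ux) -expg2 sqr_sqr.
by split=> //; apply: inv_cent.
Qed.

End Hamiltonian.

(** * Anisotropic quadratic maps to the plane over F_2 *)

Definition plane := (bool * bool)%type.

(** A row holds the value of the quadratic map on a basis vector and the values of
its polar form on that vector and each of the later ones. *)
Definition table := seq (plane * seq plane).

Definition p0 : plane := (false, false).
Definition p1 : plane := (true, false).
Definition p2 : plane := (false, true).
Definition p3 : plane := (true, true).
Definition padd (a b : plane) : plane := (a.1 (+) b.1, a.2 (+) b.2).
Arguments padd : simpl never.

Definition pscale (e : bool) (a : plane) : plane := if e then a else p0.

Fixpoint vadd (u v : seq bool) : seq bool :=
  if (u, v) is (a :: u', b :: v') then a (+) b :: vadd u' v' else [::].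

Fixpoint pdot (L : seq plane) (v : seq bool) : plane :=
  if (L, v) is (l :: L', a :: v') then padd (pscale a l) (pdot L' v') else p0.

(** A bilinear form whose diagonal is the quadratic map with table c; the form is
not symmetric, and its antisymmetrization is the polar form. *)
Fixpoint cocycle (c : table) (u v : seq bool) : plane :=
  match c, u, v with
  | (q, L) :: c', a :: u', b :: v' =>
      padd (padd (pscale (a && b) q) (pscale b (pdot L u'))) (cocycle c' u' v')
  | _, _, _ => p0
  end.

Definition qform c v := cocycle c v v.
Definition bform c u v := padd (cocycle c u v) (cocycle c v u).

Fixpoint bits n : seq (seq bool) :=
  if n is n'.+1 then
    [seq true :: v | v <- bits n'] ++ [seq false :: v | v <- bits n']
  else [:: [::]].

Definition anisotropic (c : table) :=
  all (fun v => has id v ==> (qform c v != p0)) (bits (size c)).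

Definition planes : seq plane := [:: p0; p1; p2; p3].

Fixpoint plane_lists n : seq (seq plane) :=
  if n is n'.+1 then [seq l :: L | l <- planes, L <- plane_lists n']
  else [:: [::]].

(** All the rows that can be put in front of a table with n rows. *)
Definition rows n : seq (plane * seq plane) :=
  [seq (q, L) | q <- planes, L <- plane_lists n].

(** The linear map of the plane that sends p1 to a and p2 to b. *)
Definition relabel (a b : plane) (w : plane) : plane :=
  padd (pscale w.1 a) (pscale w.2 b).
Definition relabel_table a b (c : table) : table :=
  [seq (relabel a b r.1, map (relabel a b) r.2) | r <- c].
Definition plane_bases : seq (plane * plane) :=
  [:: (p1, p2); (p2, p1); (p1, p3); (p3, p1); (p2, p3); (p3, p2)].

(** All the families of vectors that realize d in the space with table c. *)
Fixpoint realizations (c d : table) : seq (seq (seq bool)) :=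
  if d is (q, L) :: d' then
    [seq v :: vs | vs <- realizations c d',
       v <- [seq v <- bits (size c) |
              (qform c v == q) && (map (bform c v) vs == L)]]
  else [:: [::]].

(** New generators are put in front: the last two rows of a table that extends
table16 belong to y and x, with p1 and p2 standing for x^2 and y^2, and the rows
of table245 belong to v, u, y and x. *)
Definition table16 : table := [:: (p2, [:: p1]); (p1, [::])].
Definition table_inverted : table := (p2, [:: p2; p0]) :: table16.
Definition tableQ8C4 : table := [:: (p2, [:: p0; p0]); (p1, [:: p1]); (p1, [::])].
Definition table32 : table := (p2, [:: p3; p2]) :: table16.
Definition tableQ8Q8 : table :=
  [:: (p1, [:: p1; p0; p0]); (p1, [:: p0; p0]); (p2, [:: p2]); (p2, [::])].
Definition table16Q8 : table :=
  [:: (p3, [:: p3; p0; p0]), (p3, [:: p0; p0]) & table16].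
Definition table245 : table := (p1, [:: p0; p1; p3]) :: table32.

Definition normal_tables n : seq table :=
  match n with
  | 2 => [:: table16]
  | 3 => [:: table_inverted; tableQ8C4; table32]
  | 4 => [:: table16Q8; tableQ8Q8; table245]
  | _ => [::]
  end.

(** Each anisotropic extension of a normal table by one row realizes, up to the
choice of a basis of the plane, a normal table with one more row. The
conditional is not written as an implication, whose right side evaluation by
value would compute in all cases. *)
Definition extensible n :=
  all (fun c => all (fun r =>
    if all (fun v => qform (r :: c) (true :: v) != p0) (bits n) then
      has (fun d => has (fun ab =>
          ~~ nilp (realizations (r :: c) (relabel_table ab.1 ab.2 d)))
        plane_bases) (normal_tables n.+1)
    else true) (rows n)) (normal_tables n).

(** For n = 4 no table remains, so no anisotropic map to the plane has a
five-dimensional domain that extends one of these tables. *)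
Lemma normal_tables_extensible n : extensible n.
Proof. by case: n => [|[|[|[|[|n]]]]]; vm_compute. Qed.

Lemma mem_bits n v : size v = n -> v \in bits n.
Proof.
elim: n v => [|n IH] [|a v] //= [sv]; rewrite mem_cat.
by apply/orP; case: a; [left | right]; apply: map_f; apply: IH.
Qed.

Lemma size_bits n v : v \in bits n -> size v = n.
Proof.
elim: n v => [|n IH] v /=; first by rewrite inE => /eqP ->.
by rewrite mem_cat => /orP[] /mapP[u /IH <- ->].
Qed.

Lemma mem_planes a : a \in planes.
Proof. by case: a => [[] []]. Qed.

Lemma mem_plane_lists L : L \in plane_lists (size L).
Proof.
elim: L => // l L IH; rewrite /plane_lists -/plane_lists.
by apply/allpairsP; exists (l, L); split=> //; apply: mem_planes.
Qed.

Lemma mem_rows q L : (q, L) \in rows (size L).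
Proof.
apply/allpairsP; exists (q, L); split=> //; first exact: mem_planes.
exact: mem_plane_lists.
Qed.

Lemma paddA : associative padd.
Proof. by case=> [a b] [c d] [e f]; rewrite /padd /= !addbA. Qed.

Lemma paddC : commutative padd.
Proof. by case=> [a b] [c d]; rewrite /padd /= addbC (addbC b). Qed.

Lemma padd0 : left_id p0 padd.
Proof. by case. Qed.

Lemma paddr0 : right_id p0 padd.
Proof. by move=> a; rewrite paddC padd0. Qed.

Lemma paddK a : padd a a = p0.
Proof. by rewrite /padd !addbb. Qed.

Lemma paddACA : interchange padd padd.
Proof. by move=> a b c d; rewrite -!paddA (paddA b) (paddC b) -paddA. Qed.

Lemma pscaleDl e f a : pscale (e (+) f) a = padd (pscale e a) (pscale f a).
Proof. by case: e; case: f; rewrite /= ?paddK ?padd0 ?paddr0. Qed.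

Lemma pscaleDr e a b : pscale e (padd a b) = padd (pscale e a) (pscale e b).
Proof. by case: e. Qed.

Lemma size_vadd u v : size u = size v -> size (vadd u v) = size v.
Proof. by elim: u v => [|a u IH] [|b v] //= [/IH ->]. Qed.

Lemma vaddC : commutative vadd.
Proof. by elim=> [|a u IH] [|b v] //=; rewrite IH addbC. Qed.

Lemma vaddA : associative vadd.
Proof. by elim=> [|a u IH] [|b v] [|d w] //=; rewrite IH addbA. Qed.

Lemma vadd0 u : vadd (nseq (size u) false) u = u.
Proof. by elim: u => //= a u ->. Qed.

Lemma vaddK u : vadd u u = nseq (size u) false.
Proof. by elim: u => //= a u ->; rewrite addbb. Qed.

Lemma pdotD L u v : size u = size v ->
  pdot L (vadd u v) = padd (pdot L u) (pdot L v).
Proof.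
elim: L u v => [|l L IH] [|a u] [|b v] //= [suv].
by rewrite IH // pscaleDl paddACA.
Qed.

Lemma cocycleDl c u v w : size u = size v ->
  cocycle c (vadd u v) w = padd (cocycle c u w) (cocycle c v w).
Proof.
elim: c u v w => [|[q L] c IH] [|a u] [|b v] [|d w] //= [suv].
rewrite IH // pdotD // andb_addl pscaleDl pscaleDr.
by rewrite (paddACA (pscale _ _)) paddACA.
Qed.

Lemma cocycleDr c u v w : size v = size w ->
  cocycle c u (vadd v w) = padd (cocycle c u v) (cocycle c u w).
Proof.
elim: c u v w => [|[q L] c IH] [|a u] [|b v] [|d w] //= [svw].
rewrite IH // andb_addr !pscaleDl.
by rewrite (paddACA (pscale _ _)) paddACA.
Qed.

Lemma pdot0 L n : pdot L (nseq n false) = p0.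
Proof. by elim: L n => [|l L IH] [|n] //=; rewrite IH. Qed.

Lemma cocycle0l c n v : cocycle c (nseq n false) v = p0.
Proof.
elim: c n v => [|[q L] c IH] [|n] [|b v] //=.
by rewrite IH pdot0; case: b.
Qed.

Lemma cocycle0r c u n : cocycle c u (nseq n false) = p0.
Proof. by elim: c u n => [|[q L] c IH] [|a u] [|n] //=; rewrite IH andbF. Qed.

(** * Groups presented by a table *)

(** The central extension of F_2^n by the plane whose cocycle has table c. *)
Definition model (c : table) := ((size c).-tuple bool * plane)%type.

HB.instance Definition _ c := Finite.on (model c).

Section Model.
Variable c : table.
Implicit Types x y z : model c.

Lemma tuple_vadd_subproof (u v : (size c).-tuple bool) :
  size (vadd u v) == size c.
Proof. by rewrite size_vadd !size_tuple. Qed.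

Definition tuple_vadd u v := Tuple (tuple_vadd_subproof u v).

Definition model_one : model c := (nseq_tuple (size c) false, p0).
Definition model_mul x y : model c :=
  (tuple_vadd x.1 y.1, padd (padd x.2 y.2) (cocycle c x.1 y.1)).
Definition model_inv x : model c := (x.1, padd x.2 (qform c x.1)).

Lemma model_eq x y : tval x.1 = tval y.1 -> x.2 = y.2 -> x = y.
Proof. by case: x y => [u a] [v b] /= /val_inj -> ->. Qed.

Lemma model_mulA : associative model_mul.
Proof.
move=> x y z; apply: model_eq => /=; first exact: vaddA.
rewrite cocycleDl ?cocycleDr ?size_tuple // -!paddA; congr padd.
congr padd; rewrite [RHS]paddC -!paddA; congr padd.
by rewrite [LHS]paddA [LHS]paddC.
Qed.

Lemma model_mul1 : left_id model_one model_mul.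
Proof.
move=> x; apply: model_eq; rewrite /= ?cocycle0l ?padd0 ?paddr0 //.
by rewrite -{2}(vadd0 x.1) size_tuple.
Qed.

Lemma model_mulr1 : right_id model_one model_mul.
Proof.
move=> x; apply: model_eq; rewrite /= ?cocycle0r ?paddr0 //.
by rewrite vaddC -{2}(vadd0 x.1) size_tuple.
Qed.

Lemma model_mulV : left_inverse model_one model_inv model_mul.
Proof.
move=> x; apply: model_eq; rewrite /= ?vaddK ?size_tuple //.
by rewrite (paddC _ x.2) paddA paddK padd0 paddK.
Qed.

Lemma model_mulrV : right_inverse model_one model_inv model_mul.
Proof.
move=> x; apply: model_eq; rewrite /= ?vaddK ?size_tuple //.
by rewrite paddA paddK padd0 paddK.
Qed.

HB.instance Definition _ := isGroup.Build (model c)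
  model_mulA model_mul1 model_mulr1 model_mulV model_mulrV.

Lemma model_sqr x : x ^+ 2 = (nseq_tuple (size c) false, qform c x.1).
Proof.
rewrite expg2; apply: model_eq; rewrite /= ?vaddK ?size_tuple //.
by rewrite paddK padd0.
Qed.

End Model.

Section Morphisms.
Context (G H : groupType).

Lemma multiplicative_of (f : G -> H) : {morph f : x y / x * y} ->
  exists phi : {multiplicative G -> H}, phi =1 f.
Proof.
move=> fM; pose m := monoid.isMultiplicative.Build G H f fM.
by exists (HB.pack_for {multiplicative G -> H} f m).
Qed.

Lemma isomorphic_of (f : G -> H) :
  {morph f : x y / x * y} -> bijective f -> isomorphic G H.
Proof.
move=> fM bij_f; have [phi phiE] := multiplicative_of fM.
by exists phi; apply: eq_bij bij_f _ _.
Qed.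

Lemma gmorph1 (f : G -> H) : {morph f : x y / x * y} -> f 1 = 1.
Proof. by move=> fM; apply: (mulgI (f 1)); rewrite -fM !mulg1. Qed.

Lemma gmorphV (f : G -> H) : {morph f : x y / x * y} -> {morph f : x / x^-1}.
Proof.
move=> fM x; apply/esym/mulg1_eq; rewrite -fM mulgV; exact: gmorph1.
Qed.

Lemma gmorph_bij (f : G -> H) : {morph f : x y / x * y} ->
  (forall x, f x = 1 -> x = 1) -> (forall y, exists x, f x = y) -> bijective f.
Proof.
move=> fM ker surj; have [g gK] := choice surj.
exists g => // x; apply/eqP; rewrite -divg_eq1; apply/eqP/ker.
by rewrite fM gmorphV // gK mulgV.
Qed.

End Morphisms.

Lemma isomorphic_sym (G H : groupType) : isomorphic G H -> isomorphic H G.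
Proof.
case=> f [g fK gK]; apply: (@isomorphic_of _ _ g); last by exists f.
by apply: (can2_gmulfM fK gK).
Qed.

Section Frames.
Context (G : groupType) (s t : G).
Implicit Types (x y : G) (es : seq G) (c : table) (v : seq bool).

Definition central_involutions :=
  [/\ s ^+ 2 = 1, t ^+ 2 = 1, forall x, commute s x & forall x, commute t x].

(** The homomorphism from the plane that sends p1 to s and p2 to t; the case
analysis keeps it from being confused with a product by unification. *)
Definition ppow (w : plane) : G :=
  match w with
  | (false, false) => 1
  | (true, false) => s
  | (false, true) => t
  | (true, true) => s * t
  end.

Arguments ppow : simpl never.

Fixpoint vprod es v : G :=
  if (es, v) is (e :: es', a :: v') then e ^+ a * vprod es' v' else 1.

(** The squares and commutators of the elements of es are those that c prescribes,
in the subgroup generated by s and t. *)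
Fixpoint frame es c : Prop :=
  match es, c with
  | e :: es', (q, L) :: c' =>
      [/\ e ^+ 2 = ppow q, map (commg e) es' = map ppow L & frame es' c']
  | [::], [::] => True
  | _, _ => False
  end.

Hypothesis st : central_involutions.

Lemma ppowC w x : commute (ppow w) x.
Proof.
case: st => _ _ sC tC; case: w => [[] []] //=.
- exact/commute_sym/commuteM/commute_sym/tC/commute_sym/sC.
- exact/commute_sym/commute1.
Qed.

Lemma ppowE a b : ppow (a, b) = s ^+ a * t ^+ b.
Proof. by case: a; case: b; rewrite /ppow /= ?mul1g ?mulg1. Qed.

Lemma ppowM a b : ppow a * ppow b = ppow (padd a b).
Proof.
case: st a b => s2 t2 sC tC [a b] [a' b']; rewrite !ppowE mulgACA.
  by rewrite !involution_expb.
exact/commute_sym/commuteX/commute_sym/(ppowC (false, true)).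
Qed.

Lemma ppow0 : ppow p0 = 1. Proof. by []. Qed.

Lemma ppowK a : ppow a * ppow a = 1.
Proof. by rewrite ppowM paddK ppow0. Qed.

Lemma ppowV a : (ppow a)^-1 = ppow a.
Proof. by apply: mulg1_eq; apply: ppowK. Qed.

Lemma frame_size es c : frame es c -> size es = size c.
Proof. by elim: es c => [|e es IH] [|[q L] c] //= [_ _ /IH ->]. Qed.

Lemma vprod0 es : vprod es (nseq (size es) false) = 1.
Proof. by elim: es => //= e es ->; rewrite mulg1. Qed.

Lemma frame_vprod0 es c : frame es c -> vprod es (nseq (size c) false) = 1.
Proof. by move=> fr; rewrite -(frame_size fr) vprod0. Qed.

Lemma vprod_commg e es L v (b : bool) : map (commg e) es = map ppow L ->
  vprod es v * e ^+ b = e ^+ b * vprod es v * ppow (pscale b (pdot L v)).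
Proof.
case: b; last by rewrite ppow0 !mulg1 mul1g.
rewrite expg1 /=; elim: es L v => [|f es IH] [|l L] [|a v] //=;
  rewrite ?ppow0 ?mulg1 ?mul1g //.
case=> fl /IH {}IH; rewrite -mulgA IH -!ppowM !mulgA; congr (_ * _).
rewrite -[RHS]mulgA -(ppowC (pscale a l)) mulgA; congr (_ * _).
case: a; last by rewrite ppow0 /= mul1g !mulg1.
by rewrite !expg1 -fl commgC /= -invgR fl ppowV.
Qed.

(** Collecting the generators of the second factor in front of those of the first
produces exactly the cocycle. *)
Lemma vprodM es c u v : frame es c -> size u = size c -> size v = size c ->
  vprod es u * vprod es v = vprod es (vadd u v) * ppow (cocycle c u v).
Proof.
elim: es c u v => [|e es IH] [|[q L] c] [|a u] [|b v] //=.
case=> e2 eL fr [su] [sv]; rewrite mulgA -(mulgA (e ^+ a)).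
rewrite (vprod_commg _ _ eL); set P := ppow _.
have -> : e ^+ a * (e ^+ b * vprod es u * P) * vprod es v =
    e ^+ a * e ^+ b * (vprod es u * vprod es v) * P.
  by rewrite -!mulgA (ppowC _ (vprod es v)).
rewrite (IH _ _ _ fr su sv).
have -> : e ^+ a * e ^+ b = e ^+ (a (+) b) * ppow (pscale (a && b) q).
  move: (a) (b) => [] [] /=; rewrite ?ppow0 ?mulg1 ?mul1g //.
rewrite -!mulgA; congr (_ * _); rewrite (ppowC (pscale (a && b) q)) -!mulgA.
congr (_ * _); rewrite /P !ppowM; congr ppow.
by rewrite [LHS]paddC; congr padd; apply: paddC.
Qed.

Lemma vprod_sqr es c v : frame es c -> size v = size c ->
  vprod es v ^+ 2 = ppow (qform c v).
Proof.
move=> fr sv; rewrite expg2 (vprodM fr) // vaddK -[RHS]mul1g.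
by rewrite sv (frame_vprod0 fr).
Qed.

Lemma vprod_bform es c u v : frame es c -> size u = size c -> size v = size c ->
  [~ vprod es u, vprod es v] = ppow (bform c u v).
Proof.
move=> fr su sv; apply: (mulgI (vprod es v * vprod es u)).
rewrite -commgC !(vprodM fr) // vaddC -mulgA ppowM; congr (_ * ppow _).
by rewrite /bform (paddC (cocycle c u v)) paddA paddK padd0.
Qed.

Lemma frame_realization es c d vs : frame es c -> vs \in realizations c d ->
  frame [seq vprod es v | v <- vs] d /\ all (fun v => size v == size c) vs.
Proof.
move=> fr; elim: d vs => [|[q L] d IH] vs /=; first by rewrite inE => /eqP ->.
case/allpairsPdep=> us [v [/IH [frd sz]]].
rewrite mem_filter => /andP[/andP[/eqP qv /eqP bL]] /size_bits sv -> /=.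
split; last by rewrite sv eqxx.
split=> //; first by rewrite (vprod_sqr fr sv) qv.
rewrite -bL -!map_comp; apply/eq_in_map => u /(allP sz)/eqP su /=.
exact: vprod_bform.
Qed.

Definition model_map es c (x : model c) : G := vprod es x.1 * ppow x.2.

Lemma model_mapM es c : frame es c -> {morph model_map es (c := c) : x y / x * y}.
Proof.
move=> fr x y; rewrite /model_map /= -!ppowM.
rewrite [RHS]mulgACA; last exact: ppowC.
rewrite (vprodM fr) ?size_tuple // -!mulgA; congr (_ * _).
by rewrite [RHS]ppowC -!mulgA.
Qed.

Definition independent := [/\ s <> 1, t <> 1 & s <> t].

Lemma ppow_eq1 a : independent -> ppow a = 1 -> a = p0.
Proof.
case: st => s2 t2 _ _ [s1 t1 s_t]; case: a => [[] []] //=; rewrite /ppow //= => e.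
by case: s_t; apply: (mulIg t); rewrite [LHS]e -expg2.
Qed.

Lemma ppow_inj : independent -> injective ppow.
Proof.
move=> ind a b ab; have := ppowM a b; rewrite ab ppowK => /esym/(ppow_eq1 ind).
by case: a b {ab} => [[] []] [[] []].
Qed.

Lemma anisotropicP c v : anisotropic c -> size v = size c ->
  qform c v = p0 -> v = nseq (size c) false.
Proof.
move=> /allP an sv qv; have := an v; rewrite qv -sv => /(_ (mem_bits erefl)).
rewrite eqxx implybF; elim: v {sv qv an} => //= -[] v IH //= /IH e.
by rewrite {1}e.
Qed.

Lemma model_map_square es c (x : model c) : frame es c -> independent ->
  anisotropic c -> model_map es x ^+ 2 = 1 -> tval x.1 = nseq (size c) false.
Proof.
move=> fr ind an; rewrite expg2 -(model_mapM fr) -expg2 model_sqr /model_map /=.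
rewrite (frame_vprod0 fr) mul1g => /(ppow_eq1 ind).
by apply: anisotropicP; rewrite ?size_tuple.
Qed.

(** If the image of x is trivial, so is its square, and anisotropy puts x in the
plane. *)
Lemma model_map_eq1 es c (x : model c) : frame es c -> independent ->
  anisotropic c -> model_map es x = 1 -> x = 1.
Proof.
move=> fr ind an x1; have x0 : tval x.1 = nseq (size c) false.
  by apply: (model_map_square fr) => //; rewrite x1 expg1n.
apply: model_eq => //; apply: (ppow_eq1 ind).
by move: x1; rewrite /model_map x0 (frame_vprod0 fr) mul1g.
Qed.

Lemma model_isomorphic es c : frame es c -> independent -> anisotropic c ->
  (forall g, exists x : model c, model_map es x = g) -> isomorphic (model c) G.
Proof.
move=> fr ind an surj; apply: (isomorphic_of (model_mapM fr)).
by apply: gmorph_bij (model_mapM fr) _ surj => x; apply: model_map_eq1.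
Qed.

End Frames.

Arguments ppow : simpl never.

(** * Good groups with squares in a plane *)

Lemma size_normal_table n c : c \in normal_tables n -> size c = n.
Proof.
have /allP normal : all (fun c => size c == n) (normal_tables n).
  by case: n => [|[|[|[|[|n]]]]].
by move/normal/eqP.
Qed.

Lemma normal_table_anisotropic n c : c \in normal_tables n -> anisotropic c.
Proof.
have /allP normal : all anisotropic (normal_tables n).
  by case: n => [|[|[|[|[|n]]]]].
exact: normal.
Qed.

Lemma normal_table_extension n c q L : c \in normal_tables n -> size L = n ->
    (forall v, size v = n -> qform ((q, L) :: c) (true :: v) <> p0) ->
  exists d a b vs, [/\ d \in normal_tables n.+1, (a, b) \in plane_bases
    & vs \in realizations ((q, L) :: c) (relabel_table a b d)].
Proof.
move=> cn sL an; have := mem_rows q L; rewrite sL.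
have /allP/(_ c cn)/allP/[apply] := normal_tables_extensible n.
case: ifP => [_ /hasP[d dn /hasP[[a b] ab]] | /negP[]]; last first.
  by apply/allP => v /size_bits/an/eqP.
case vsE: (realizations _ _) => [|vs R] // _.
by exists d, a, b, vs; split; rewrite // vsE mem_head.
Qed.

Lemma plane_basesP a b : (a, b) \in plane_bases ->
  [/\ a != p0, b != p0, a != b & forall w, exists w', relabel a b w' = w].
Proof.
move=> ab; have /allP/(_ _ ab)/and4P[a0 b0 a_b /allP onto] :
  all (fun ab : plane * plane =>
    [&& ab.1 != p0, ab.2 != p0, ab.1 != ab.2 &
        all (fun w => has (fun w' => relabel ab.1 ab.2 w' == w) planes) planes])
  plane_bases by [].
split=> // w; have /onto/hasP[w' _ /eqP <-] := mem_planes w.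
by exists w'.
Qed.

Section Classification.
Context (G : groupType).
Hypothesis invC : involutions_central G.
Hypothesis exp4 : forall x : G, x ^+ 4 = 1.
Implicit Types (x y g s t : G) (es : seq G) (c : table) (v : seq bool).

Definition framed s t es c :=
  [/\ central_involutions s t, independent s t,
      forall x, exists a, x ^+ 2 = ppow s t a & frame s t es c].

(** Every element is, up to an involution, a product of elements of es. *)
Definition covers es :=
  forall x, exists2 v, size v = size es & (x * vprod es v) ^+ 2 = 1.

Lemma relabel_ppow s t a b w : central_involutions s t ->
  ppow (ppow s t a) (ppow s t b) w = ppow s t (relabel a b w).
Proof.
move=> st; case: w => [[] []]; rewrite /relabel /= ?padd0 ?paddr0 //.
by rewrite -ppowM.
Qed.

Lemma frame_relabel s t a b es c : central_involutions s t ->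
  frame s t es (relabel_table a b c) -> frame (ppow s t a) (ppow s t b) es c.
Proof.
move=> st; elim: es c => [|e es IH] [|[q L] c] //= [e2 eL /IH fr].
split=> //; first by rewrite relabel_ppow.
by rewrite eL -map_comp; apply: eq_map => l /=; rewrite relabel_ppow.
Qed.

Lemma commg_ppow s t es c : framed s t es c ->
  forall x y, exists a, [~ x, y] = ppow s t a.
Proof.
case=> st _ sq _ x y; rewrite (commg_sqrE invC exp4).
have [a ->] := sq x; have [b ->] := sq y; have [d ->] := sq (x * y).
by rewrite !ppowM //; eexists.
Qed.

(** A new generator extends the table by a row; it is anisotropic because no
product of the new generator with the old ones is an involution. *)
Lemma framed_extend n s t es c : c \in normal_tables n ->
    framed s t es c -> ~ covers es ->
  exists s' t' es' c', c' \in normal_tables n.+1 /\ framed s' t' es' c'.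
Proof.
move=> cn fr_c; have cS := commg_ppow fr_c.
case: fr_c => st ind sq fr ncov.
have [g gP] : exists g, forall v, size v = size es -> (g * vprod es v) ^+ 2 <> 1.
  apply: contrapT => nog; apply: ncov => g; apply: contrapT => nov; apply: nog.
  by exists g => v sv gv; apply: nov; exists v.
have [q gq] := sq g.
have [L [sL gL]] : exists L,
    size L = size es /\ map (commg g) es = map (ppow s t) L.
  elim: {c cn fr ncov gP} es => [|e es [L [sL gL]]]; first by exists [::].
  by have [l gl] := cS g e; exists (l :: L); rewrite /= sL gL gl.
have fr' : frame s t (g :: es) ((q, L) :: c) by [].
have szes : size es = n by rewrite (frame_size fr) (size_normal_table cn).
have [||d [a [b [vs [dn /plane_basesP[a0 b0 ab onto]]]]]] :=
    normal_table_extension (q := q) (L := L) cn.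
- by rewrite sL.
- move=> v sv qv; apply: (gP v); first by rewrite sv.
  have := vprod_sqr st (v := true :: v) fr'.
  by rewrite qv /= sv -szes (frame_size fr) => ->.
case/(frame_realization st fr') => /(frame_relabel st) fr_d _.
exists (ppow s t a), (ppow s t b), [seq vprod (g :: es) v | v <- vs], d.
split=> //; have inj := ppow_inj st ind; split=> // [||x].
- by split=> [||x|x]; rewrite ?expg2 ?ppowK //; apply: ppowC.
- split=> /eqP; apply/negP.
  + by apply: contra a0 => /eqP e; apply/eqP/inj.
  + by apply: contra b0 => /eqP e; apply/eqP/inj.
  + by apply: contra ab => /eqP/inj/eqP.
- have [w ->] := sq x; have [w' <-] := onto w; exists w'.
  by rewrite relabel_ppow.
Qed.

Lemma framed_cover n s t es c : c \in normal_tables n -> framed s t es c ->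
  exists n' s' t' es' c',
    [/\ c' \in normal_tables n', framed s' t' es' c' & covers es'].
Proof.
(* There are no normal tables with more than four rows. *)
have [m] := ubnP (5 - n); elim: m n s t es c => // m IH n s t es c le_m cn fr.
have [cov|ncov] := pselect (covers es); first by exists n, s, t, es, c.
have [s' [t' [es' [c' [cn' fr']]]]] := framed_extend cn fr ncov.
apply: (IH n.+1 s' t' es' c') => //; move: le_m cn.
by case: (n) => [|[|[|[|[|k]]]]].
Qed.

End Classification.

(** The element with coordinates uv inverts the centralizer of the one with
coordinates wv, which has index 2. *)
Definition inverting c wv uv :=
  [&& size wv == size c, size uv == size c,
      qform c uv != p0, bform c wv uv != p0 &
   all (fun v =>
      let good v := (bform c wv v == p0) && (bform c uv v == qform c v) in
      good v || good (vadd uv v)) (bits (size c))].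

Section Subgroup.
Variables (G : groupType) (A : {pred G}) (clA : group_closed A).

Definition subgroup_of (_ : group_closed A) := {x : G | A x}.

HB.instance Definition _ := SubChoice.on (subgroup_of clA).
HB.instance Definition _ := SubChoice_isSubGroup.Build G A (subgroup_of clA) clA.

End Subgroup.

Section Complement.
Local Open Scope classical_set_scope.
Context (G : groupType).
Hypothesis invC : involutions_central G.
Variables (s t : G).
Implicit Types (x y z : G) (A B : set G).

Let partial_complement A :=
  [/\ forall x y, A x -> A y -> A (x * y), forall x, A x -> x ^+ 2 = 1
    & forall a, A (ppow s t a) -> ppow s t a = 1].

(** A maximal elementary abelian subgroup meeting the span of s and t trivially
is a complement. *)
Lemma involution_complement : exists E : {pred G},
  [/\ group_closed E, forall x, x \in E -> x ^+ 2 = 1,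
      forall a, ppow s t a \in E -> ppow s t a = 1 &
      forall z, z ^+ 2 = 1 -> exists2 e, e \in E & exists a, z = e * ppow s t a].
Proof.
have [F FP totF|A [[AM A2 AS] maxA]] := @Zorn_bigcup _ partial_complement.
  split=> [x y [B FB Bx] [D FD Dy]|x [B FB Bx]|a [B FB Ba]].
  - have [BD|DB] := totF _ _ FB FD.
      by exists D => //; have [DM _ _] := FP _ FD; apply: DM => //; apply: BD.
    by exists B => //; have [BM _ _] := FP _ FB; apply: BM => //; apply: DB.
  - by have [_ B2 _] := FP _ FB; apply: B2.
  - by have [_ _ BS] := FP _ FB; apply: BS.
pose E : {pred G} := fun x => `[< A x \/ x = 1 >].
have EP x : reflect (A x \/ x = 1) (x \in E) by exact: asboolP.
have E2 x : x \in E -> x ^+ 2 = 1.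
  by case/EP=> [/A2 | ->] //; rewrite expg1n.
have EM x y : x \in E -> y \in E -> x * y \in E.
  case/EP=> [Ax|->]; last by rewrite mul1g.
  case/EP=> [Ay|->]; last by rewrite mulg1; apply/EP; left.
  by apply/EP; left; apply: AM.
have clE : group_closed E.
  split=> [|x y Ex Ey]; first by apply/EP; right.
  by rewrite involutionV ?E2 //; apply: EM.
have ES a : ppow s t a \in E -> ppow s t a = 1 by case/EP=> [/AS|].
exists E; split=> // z z2; apply: contrapT => nz.
have zC y : commute z y := invC y z2.
pose B x := exists2 e, e \in E & x = e \/ x = z * e.
have nzS e a : e \in E -> z * e <> ppow s t a.
  move=> Ee zea; apply: nz; exists e => //; exists a.
  by rewrite -zea (zC e) mulgA -expg2 E2 // mul1g.
have AB : A `<=` B by move=> x Ax; exists x; [apply/EP; left | left].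
have Bz : B z by exists 1; [apply/EP; right | right; rewrite mulg1].
apply: (maxA B).
  split=> // /(_ z Bz) Az; apply: (nzS z p0); first by apply/EP; left.
  by rewrite -expg2 z2.
split=> [x y|x|a].
- move=> [e Ee ex] [f Ef fy]; exists (e * f); first exact: EM.
  case: ex => ->; case: fy => ->; first by left.
  + by right; rewrite mulgA -(zC e) -mulgA.
  + by right; rewrite mulgA.
  + by left; rewrite mulgA -(mulgA z) -(zC e) mulgA -expg2 z2 mul1g.
- case=> e Ee [] ->; first exact: E2.
  by rewrite expgMn // z2 E2 // mulg1.
- by case=> e Ee [ea|/esym/(nzS _ _ Ee)] //; apply: ES; rewrite ea.
Qed.

End Complement.

Section Covered.
Context (G : groupType).
Hypothesis invC : involutions_central G.
Hypothesis exp4 : forall x : G, x ^+ 4 = 1.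
Variables (s t : G) (es : seq G) (c : table).
Hypothesis fr : framed s t es c.
Hypothesis cov : covers es.
Implicit Types (x y : G) (v : seq bool).

Let st : central_involutions s t. Proof. by case: fr. Qed.
Let ind : independent s t. Proof. by case: fr. Qed.
Let fre : frame s t es c. Proof. by case: fr. Qed.

(** With p the given product and xp of order at most 2, the second factor is
xp times p^-2. *)
Lemma covers_factor x : exists v z,
  [/\ size v = size c, z ^+ 2 = 1 & x = vprod es v * z].
Proof.
have [v sv xv] := cov x; have sz := frame_size fre.
pose p := vprod es v; exists v, (x * p * p ^- 2); split; first by rewrite sv.
- by apply: involution_mul; rewrite // -expVgn sqr_sqr.
- rewrite -/p -[RHS]invC; last first.
    by apply: involution_mul; rewrite // -expVgn sqr_sqr.
  by rewrite expg2 invgM mulgA mulgK mulgVK.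
Qed.

Lemma inverting_inverted wv uv : inverting c wv uv -> inverted_by_order4 G.
Proof.
case/and5P=> /eqP sw /eqP su /eqP qu /eqP wu /allP good.
have inj := ppow_inj st ind; have p01 := ppow0 s t.
apply: (@inverted_of_cover _ invC exp4 (vprod es wv) (vprod es uv)) => [||x].
- by rewrite (vprod_sqr st fre) // -p01 => /inj.
- by rewrite (vprod_bform st fre) // -p01 => /inj.
have goodP v z (p := vprod es v * z) : size v = size c -> z ^+ 2 = 1 ->
    (bform c wv v == p0) && (bform c uv v == qform c v) ->
    [~ vprod es wv, p] = 1 /\ [~ vprod es uv, p] = p ^+ 2.
  move=> sv z2 /andP[/eqP bw /eqP bu]; have zC y : commute z y := invC y z2.
  have comm_z u : [~ u, p] = [~ u, vprod es v].
    rewrite commgM_r // -[RHS]mulg1; congr (_ * _).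
    exact/eqP/commgP/commute_sym.
  rewrite !comm_z [p ^+ 2]expgMn ?z2 ?mulg1; last exact/commute_sym.
  by rewrite !(vprod_bform st fre) // (vprod_sqr st fre) // bw bu.
have [v [z [sv z2 ->]]] := covers_factor x.
have [vP|vP] := orP (good v (mem_bits sv)); [left | right]; first exact: goodP.
rewrite mulgA (vprodM st fre) // -mulgA; apply: goodP => //.
  by rewrite size_vadd ?su.
by apply: involution_mul; rewrite // expg2 ppowK.
Qed.

(** The involutions split as the direct product of the plane of squares and a
complement E; the model maps isomorphically onto a complement of E in G. *)
Lemma covered_split : anisotropic c -> exists E : groupType,
  elementary_abelian 2 E /\ isomorphic G (E * model c)%type.
Proof.
move=> an; have [E [clE E2 ES Efull]] := involution_complement invC s t.
have memE (e : subgroup_of clE) : val e \in E := valP e.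
exists (subgroup_of clE); split.
  split=> [x y|x]; apply: val_inj; rewrite ?valM.
    by apply: invC; apply: E2; apply: memE.
  by rewrite -expg2 E2 ?val1 //; apply: memE.
apply: isomorphic_sym.
pose f (x : subgroup_of clE * model c) := val x.1 * model_map s t es x.2.
have fM : {morph f : x y / x * y}.
  move=> [e x] [e' y]; rewrite /f.
  rewrite -[LHS]/(val (e * e') * model_map s t es (x * y)) valM.
  rewrite (model_mapM st fre) mulgACA //.
  exact: invC _ (E2 _ (memE e')).
apply: (isomorphic_of fM); apply: gmorph_bij fM _ _ => [[e x]|x].
  rewrite /f /= => ex1; have e2 : val e ^+ 2 = 1 by apply/E2/memE.
  have xe : model_map s t es x = val e.
    by apply: (mulgI (val e)); rewrite ex1 -expg2 e2.
  have x0 : tval x.1 = nseq (size c) false.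
    by apply: (model_map_square st fre) => //; rewrite xe.
  have e1 : val e = 1.
    move: xe; rewrite /model_map x0 (frame_vprod0 fre) mul1g => xe.
    by rewrite -xe; apply: ES; rewrite xe; apply: memE.
  congr pair; first exact: val_inj.
  by apply: (model_map_eq1 st fre) => //; rewrite xe.
have [v [z [/eqP sv z2 ->]]] := covers_factor x.
have [e Ee [a ->]] := Efull z z2.
exists (exist _ e Ee, (Tuple sv, a)).
by rewrite /f /model_map /= !mulgA (invC (vprod es v) (E2 e Ee)).
Qed.

End Covered.

Definition listed_table c :=
  [\/ c = tableQ8C4, c = tableQ8Q8, c = table16Q8
    | c = table32 \/ c = table245].

Lemma normal_table_cases n c : c \in normal_tables n ->
  (exists wv uv, inverting c wv uv) \/
  listed_table c.
Proof.
case: n => [|[|[|[|[|n]]]]] //; rewrite !inE.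
- by move/eqP->; left; exists [:: false; true], [:: true; false].
- case/or3P=> /eqP ->.
  + by left; exists [:: false; false; true], [:: false; true; false].
  + by right; apply: Or41.
  + by right; apply: Or44; left.
- case/or3P=> /eqP ->; right.
  + exact: Or43.
  + exact: Or42.
  + by apply: Or44; right.
Qed.

(** The elements u and w of unequal squares supply a table with two rows, from
which a table of generators of G modulo involutions is reached. *)
Lemma good_structure (G : groupType) : good G -> ~ commutative_group G ->
  inverted_by_order4 G \/
  exists (E : groupType) c, [/\ elementary_abelian 2 E,
    isomorphic G (E * model c)%type &
    listed_table c].
Proof.
move=> goodG nabG.
have [|ninv] := pselect (inverted_by_order4 G); [by left | right].
have exp4 := good_small_order goodG nabG ninv.
have invC : involutions_central G := goodG.1.
have [//|[u [w [uw [u2 w2 uw2]]]]] := unequal_squares_or_inverted goodG exp4 nabG.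
pose s := w ^+ 2; pose t := u ^+ 2.
have sq x : exists a, x ^+ 2 = ppow s t a.
  apply: contrapT => nx; apply: ninv.
  apply: (large_square_span_inverted goodG exp4 u2 w2 uw2 uw (y := x)).
  case=> a [b xab]; apply: nx; exists (b, a); rewrite xab ppowE.
  by apply: (commuteX2 _ _ (commute_sqr invC exp4 u _)).
have st : central_involutions s t.
  by split; rewrite ?sqr_sqr // => x; apply: commute_sqr.
have fr : framed s t [:: u; w] table16.
  split=> //; first by split=> // e; apply: uw2.
  by split=> //=; rewrite ?uw.
have [n [s' [t' [es [c [cn fr' cov]]]]]] :=
  framed_cover invC exp4 (mem_head _ _ : table16 \in normal_tables 2) fr.
have inv_table := inverting_inverted invC exp4 fr' cov.
have [[wv [uv /inv_table//]]|cP] := normal_table_cases cn.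
have [E [elE isoE]] :=
  covered_split invC exp4 fr' cov (normal_table_anisotropic cn).
by exists E, c.
Qed.

(** * The listed structures are good *)

Lemma good_isomorphic (G H : groupType) : isomorphic G H -> good H -> good G.
Proof.
case=> f /bij_inj injf [invC goodP]; split=> [t x t2|x y].
  apply: injf; rewrite !gmulfM; apply: invC.
  by rewrite expg2 -gmulfM -expg2 t2 (gmorph1 (@gmulfM _ _ f)).
have fV := gmorphV (@gmulfM _ _ f).
have fJ a b : f (a ^ b) = f a ^ f b by rewrite /conjg !gmulfM fV.
have [e|e|e|[e e4]] := goodP (f x) (f y).
- by apply: Or41; apply: injf; rewrite !gmulfM.
- by apply: Or42; apply: injf; rewrite fJ fV.
- by apply: Or43; apply: injf; rewrite fJ fV.
- apply: Or44; split; apply: injf; rewrite ?expg2 ?gmulfM //.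
  by rewrite (gmorph1 (@gmulfM _ _ f)) -e4.
Qed.

Lemma good_prod (E H : groupType) :
  elementary_abelian 2 E -> good H -> good (E * H)%type.
Proof.
case=> cE E2 [invC goodP].
have EV (e : E) : e^-1 = e by apply: mulg1_eq; rewrite -expg2.
have EJ (e f : E) : e ^ f = e by rewrite conjgE cE mulgK.
split=> [[e t] [f x] /(congr1 snd) /= t2|[e x] [f y]].
  by congr pair; [apply: cE | apply: invC].
have [xy|xy|xy|[xy x4]] := goodP x y.
- by apply: Or41; congr pair; [apply: cE | apply: xy].
- by apply/Or42/(congr2 pair (_ : e ^ f = e^-1) xy); rewrite EV EJ.
- by apply/Or43/(congr2 pair (_ : f ^ e = f^-1) xy); rewrite EV EJ.
- apply: Or44; split.
    by apply: (congr2 pair (_ : e ^+ 2 = f ^+ 2) xy); rewrite !E2.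
  by apply: (congr2 pair (_ : e ^+ 4 = 1) x4); rewrite (expgnA e 2 2) E2.
Qed.

(** Elements outside the inverted subgroup all have the same square, of order 2,
and invert that subgroup. *)
Lemma good_inverted (H : groupType) : inverted_by_order4 H -> good H.
Proof.
case=> A [b [[A1 AF] AC [t tA cov] [_ b4 bmin] invb]].
have b2 : b ^+ 2 <> 1 by apply: bmin.
have AV x : x \in A -> x^-1 \in A by move=> xA; rewrite -[x^-1]mul1g AF.
have bA : b \notin A.
  apply/negP => /invb; rewrite [b ^ b]conjgE mulKg => e.
  by apply: b2; rewrite expg2 {1}e mulVg.
have out x : x \notin A -> exists2 a, a \in A & x = b * a.
  move=> xA; exists (b^-1 * x); last by rewrite mulVKg.
  have [|tx] := cov x; first by rewrite (negbTE xA).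
  have [|tb] := cov b; first by rewrite (negbTE bA).
  have -> : b^-1 * x = (t^-1 * b)^-1 * (t^-1 * x).
    by rewrite invgM invgK -mulgA mulVKg.
  by rewrite -[t^-1 * x]invgK; apply: AF; apply: AV.
have sqr_out a : a \in A -> (b * a) ^+ 2 = b ^+ 2.
  move=> aA; rewrite expg2 mulgA -(mulgA b a b) (conjgC a b) invb //.
  by rewrite !mulgA mulgVK -expg2.
have b4' : (b ^+ 2) ^+ 2 = 1 by rewrite -expgnA.
have inv_out x a : x \in A -> a \in A -> x ^ (b * a) = x^-1.
  by move=> xA aA; rewrite conjgM invb // conjgE (AC _ a (AV _ xA) aA) mulKg.
split=> [z x z2|x y].
  have zA : z \in A.
    apply: contrapT => /negP/out[a aA ez]; apply: b2.
    by rewrite -(sqr_out a aA) -ez.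
  have [xA|/out[a aA ->]] := boolP (x \in A); first exact: AC.
  apply/commuteE; rewrite inv_out //; apply: mulg1_eq.
  by rewrite -expg2.
have [xA|/out[a aA ->]] := boolP (x \in A);
  have [yA|/out[a' aA' ->]] := boolP (y \in A).
- by apply: Or41; apply: AC.
- by apply: Or42; apply: inv_out.
- by apply: Or43; apply: inv_out.
- apply: Or44; rewrite (sqr_out _ aA) (sqr_out _ aA'); split=> //.
  by rewrite (expgnA (b * a) 2 2) (sqr_out _ aA).
Qed.

(** The squares of x, y and xy are nonzero vectors of the plane unless x and y
commute: two of them are equal, or all three have sum zero and x commutes
with y. *)
Lemma good_of_plane_squares (G : groupType) (s t : G) :
    involutions_central G -> central_involutions s t ->
    (forall x, exists a, x ^+ 2 = ppow s t a) -> good G.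
Proof.
move=> invC st sq; have exp4 (x : G) : x ^+ 4 = 1.
  by have [a xa] := sq x; rewrite (expgnA x 2 2) xa expg2 ppowK.
split=> // x y; have [a xa] := sq x; have [b yb] := sq y.
have [d xyd] := sq (x * y).
have neq0 z a' : z ^+ 2 = ppow s t a' -> a' = p0 -> forall w, commute z w.
  by move=> z2 a0 w; apply: invC; rewrite z2 a0 ppow0.
have [a0|a0] := eqVneq a p0; first exact/Or41/(neq0 _ _ xa a0).
have [b0|b0] := eqVneq b p0; first exact/Or41/commute_sym/(neq0 _ _ yb b0).
have [d0|d0] := eqVneq d p0.
  apply: Or41; have := neq0 _ _ xyd d0 x.
  by rewrite /commute -mulgA => /mulgI.
have xy := commg_sqrE invC exp4 x y; rewrite xa yb xyd !ppowM // in xy.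
have [e|e|e|e] : [\/ padd (padd a b) d = p0, padd (padd a b) d = a,
    padd (padd a b) d = b | a = b].
  move: a b d a0 b0 d0 {xa yb xyd xy}.
  by case=> [[] []] [[] []] [[] []] // _ _ _;
    first [exact: Or44 | exact: Or41 | exact: Or42 | exact: Or43].
- by apply: Or41; apply/commgP/eqP; rewrite xy e ppow0.
- by apply: Or42; apply: (conj_inverse4 exp4); rewrite xy e.
- apply: Or43; apply: (conj_inverse4 exp4).
  by rewrite (commgC_sym invC exp4) xy e.
- by apply: Or44; rewrite xa yb e.
Qed.

Definition model_central c a : model c := ((model_one c).1, a).

Lemma model_centralC c a (x : model c) : commute (model_central c a) x.
Proof.
apply: model_eq => /=; first exact: vaddC.
by rewrite cocycle0l cocycle0r !paddr0 paddC.
Qed.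

Lemma model_centralM c a b :
  model_central c a * model_central c b = model_central c (padd a b).
Proof.
apply: model_eq => /=; last by rewrite cocycle0l paddr0.
by rewrite vaddK size_nseq.
Qed.

Lemma model_central_ppow c a :
  ppow (model_central c p1) (model_central c p2) a = model_central c a.
Proof. by case: a => [[] []] //; rewrite /ppow model_centralM. Qed.

Lemma good_model c : anisotropic c -> good (model c).
Proof.
move=> an.
apply: (@good_of_plane_squares _ (model_central c p1) (model_central c p2)).
- move=> x y; rewrite model_sqr => -[] /(anisotropicP an) x0.
  have -> : x = model_central c x.2.
    by apply: model_eq => //=; apply: x0; rewrite size_tuple.
  exact: model_centralC.
- by split=> [||x|x]; rewrite ?expg2 ?model_centralM //; apply: model_centralC.
- by move=> x; exists (qform c x.1); rewrite model_sqr model_central_ppow.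
Qed.

(** * Maps out of presented groups *)

Section QuotientMaps.
Context (T : baseGroupType) (R : T -> T -> Prop).

Lemma gclassM x y : gclass R (x * y) = gclass R x * gclass R y.
Proof. exact/esym/gqmulE. Qed.

Lemma gclassV x : gclass R x^-1 = (gclass R x)^-1.
Proof. exact/esym/gqinvE. Qed.

Lemma gclassX x n : gclass R (x ^+ n) = gclass R x ^+ n.
Proof.
elim: n => [|[|n] IH] //.
by rewrite expgSS gclassM IH expgSS.
Qed.

Lemma gclassR x y : gclass R [~ x, y] = [~ gclass R x, gclass R y].
Proof. by rewrite /commg /conjg !gclassM !gclassV. Qed.

Lemma gclass_rel x y : R x y -> gclass R x = gclass R y.
Proof. by move=> xy; apply/gclassP/GCrel. Qed.

Lemma gclass_surj (u : group_quotient R) : exists x, gclass R x = u.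
Proof. by exists (grepr u); apply: greprK. Qed.

Lemma quotient_lift (H : groupType) (f : T -> H) :
    {morph f : x y / x * y} -> {morph f : x / x^-1} -> f 1 = 1 ->
    (forall x y, R x y -> f x = f y) ->
  exists2 F : group_quotient R -> H, {morph F : u v / u * v}
    & forall x, F (gclass R x) = f x.
Proof.
move=> fM fV f1 fR; have f_congr x y : group_congr R x y -> f x = f y.
  elim=> {x y} //=.
  - by move=> x y z _ -> _ ->.
  - by move=> x x' y y' _ ex _ ey; rewrite !fM ex ey.
  - by move=> x x' _ ex; rewrite !fV ex.
  - by move=> x y z; rewrite !fM mulgA.
  - by move=> x; rewrite fM f1 mul1g.
  - by move=> x; rewrite fM fV f1 mulVg.
pose F (u : group_quotient R) := f (grepr u).
have FE x : F (gclass R x) = f x by apply/f_congr/gclassP/greprK.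
exists F => // u v; have [[x <-] [y <-]] := (gclass_surj u, gclass_surj v).
by rewrite -gclassM !FE fM.
Qed.

End QuotientMaps.

Section Presented.
Context (X : Type) (rels : seq (word X * word X)).
Local Notation cls := (gclass (fun l r => List.In (l, r) rels)).

Lemma presented_ind (P : presented rels -> Prop) :
    P 1 -> (forall u v, P u -> P v -> P (u * v)) -> (forall u, P u -> P u^-1) ->
    (forall x, P (cls (Gen x))) -> forall u, P u.
Proof.
move=> P1 PM PV Pgen u; have [w <-] := gclass_surj u.
elim: w => [x|//|w1 IH1 w2 IH2|w IH].
- exact: Pgen.
- by have := PM _ _ IH1 IH2; rewrite -gclassM.
- by have := PV _ IH; rewrite -gclassV.
Qed.

Fixpoint word_eval (H : groupType) (f : X -> H) (w : word X) : H :=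
  match w with
  | Gen x => f x
  | WordOne => 1
  | WordMul w1 w2 => word_eval f w1 * word_eval f w2
  | WordInv w1 => (word_eval f w1)^-1
  end.

Lemma presented_lift (H : groupType) (f : X -> H) :
    (forall l r, List.In (l, r) rels -> word_eval f l = word_eval f r) ->
  exists2 F : presented rels -> H, {morph F : u v / u * v}
    & forall x, F (cls (Gen x)) = f x.
Proof.
move=> frels; have [F FM FE] : exists2 F : presented rels -> H,
    {morph F : u v / u * v} & forall x, F (cls x) = word_eval f x.
  exact: quotient_lift.
by exists F => // x; rewrite FE.
Qed.

Lemma presented_commute z : (forall x, commute z (cls (Gen x))) ->
  forall u, commute z u.
Proof.
move=> zC; apply: presented_ind => // [|u v|u]; first exact: commute1.
- exact: commuteM.
- exact: commuteV.
Qed.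

End Presented.

(** The homomorphism F separates s and t, so anisotropy makes the map from the
model injective. *)
Lemma model_isomorphic_of (G : groupType) c s t es (F : G -> model c) :
    central_involutions s t -> frame s t es c -> anisotropic c ->
    {morph F : x y / x * y} ->
    F s = model_central c p1 -> F t = model_central c p2 ->
    (forall g, exists x : model c, model_map s t es x = g) ->
  isomorphic G (model c).
Proof.
move=> st fr an FM Fs Ft surj; apply: isomorphic_sym.
apply: (model_isomorphic st fr _ an surj).
have F1 := gmorph1 FM; split=> e; move: (congr1 F e); rewrite ?F1 ?Fs ?Ft //.
Qed.

Section ImageOfModel.
Context (G : groupType) (c : table) (s t : G) (es : seq G).
Hypothesis st : central_involutions s t.
Hypothesis fr : frame s t es c.

Definition in_model_map g := exists x : model c, model_map s t es x = g.

Lemma in_model_mapM g h :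
  in_model_map g -> in_model_map h -> in_model_map (g * h).
Proof. by case=> x <- [y <-]; exists (x * y); apply: (model_mapM st fr). Qed.

Lemma in_model_map1 : in_model_map 1.
Proof. by exists 1; apply: gmorph1 (model_mapM st fr). Qed.

Lemma in_model_mapV g : in_model_map g -> in_model_map g^-1.
Proof. by case=> x <-; exists x^-1; apply: gmorphV (model_mapM st fr) _. Qed.

Lemma in_model_map_frame g : List.In g es -> in_model_map g.
Proof.
move=> g_es; have [v sv <-] : exists2 v, size v = size c & vprod es v = g.
  rewrite -(frame_size fr); elim: (es) g_es => //= e l IH [->|/IH [v sv <-]].
    exists (true :: nseq (size l) false); first by rewrite /= size_nseq.
    by rewrite vprod0 mulg1.
  by exists (false :: v); rewrite /= ?sv ?mul1g.
move/eqP: sv => sv; exists (Tuple sv, p0).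
by rewrite /model_map /= ppow0 mulg1.
Qed.

End ImageOfModel.

Section CentralSquares.
Context (G : groupType).
Implicit Types x y u : G.

Lemma inverse_of_relation x y : x ^+ 2 = [~ y, x] -> x ^ y = x^-1.
Proof.
by rewrite commgEr expg2 => /mulIg e; apply: invg_inj; rewrite invgK -conjVg -e.
Qed.

Lemma commute_inverted_sqr x y : x ^ y = x^-1 -> commute x (y ^+ 2).
Proof. by move=> xy; apply/commuteE; rewrite expg2 conjgM xy conjVg xy invgK. Qed.

Lemma commute_sqr_inverted x y : x ^+ 4 = 1 -> x ^ y = x^-1 -> commute (x ^+ 2) y.
Proof.
move=> x4 xy; apply/commuteE; rewrite conjXg xy expVgn.
by apply: mulg1_eq; rewrite -expgnDr.
Qed.

Lemma inverse_of_relation_sym x y :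
  x ^+ 4 = 1 -> x ^+ 2 = [~ x, y] -> x ^ y = x^-1.
Proof.
move=> x4 xy; rewrite -[x ^ y](mulVKg x) -/(commg x y) -xy -expgS.
by apply/esym/mulg1_eq; rewrite -expgS.
Qed.

End CentralSquares.

Section Group32.
Let cls : word gen3 -> H32 := gclass (fun l r => List.In (l, r) rels32).
Let x := cls (Gen X3).
Let y := cls (Gen Y3).
Let u := cls (Gen U3).

Let rel l r : List.In (l, r) rels32 -> cls l = cls r.
Proof. exact: gclass_rel. Qed.

Let x4 : x ^+ 4 = 1.
Proof. by rewrite -gclassX; apply: rel; left. Qed.
Let y4 : y ^+ 4 = 1.
Proof. by rewrite -gclassX; apply: rel; right; left. Qed.
Let yx : x ^+ 2 = [~ y, x].
Proof. by rewrite -gclassX -gclassR; apply: rel; do 2 right; left. Qed.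
Let yu : y ^+ 2 = u ^+ 2.
Proof. by rewrite -!gclassX; apply: rel; do 3 right; left. Qed.
Let ux : y ^+ 2 = [~ u, x].
Proof. by rewrite -gclassX -gclassR; apply: rel; do 4 right; left. Qed.
Let uy : x ^+ 2 * y ^+ 2 = [~ u, y].
Proof. by rewrite -!gclassX -gclassM -gclassR; apply: rel; do 5 right; left. Qed.

Lemma isomorphic_H32 : isomorphic H32 (model table32).
Proof.
have xy : x ^ y = x^-1 := inverse_of_relation yx.
have u4 : u ^+ 4 = 1 by rewrite (expgnA u 2 2) -yu -expgnA y4.
have u_x : u ^ x = u^-1 by apply: inverse_of_relation_sym => //; rewrite -yu.
have st : central_involutions (x ^+ 2) (y ^+ 2).
  split; rewrite -?expgnA //; apply: presented_commute => -[].
  - exact/commute_sym/commuteX.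
  - exact: commute_sqr_inverted.
  - exact/commute_sym/commute_inverted_sqr.
  - exact/commute_sym/commute_inverted_sqr.
  - exact/commute_sym/commuteX.
  - by rewrite yu; apply/commute_sym/commuteX.
have fr : frame (x ^+ 2) (y ^+ 2) [:: u; y; x] table32.
  by rewrite /= -ux -uy -yx -yu.
pose f g : model table32 := match g with
  | X3 => ([tuple false; false; true], p0)
  | Y3 => ([tuple false; true; false], p0)
  | U3 => ([tuple true; false; false], p0) end.
have [|F FM Fgen] := @presented_lift _ rels32 _ f.
  by move=> l r; do 6?[case=> [[<- <-]|]] => //; apply: model_eq.
apply: (model_isomorphic_of st fr _ FM) => //.
- by rewrite expg2 FM Fgen; apply: model_eq.
- by rewrite expg2 FM Fgen; apply: model_eq.
- apply: presented_ind => [|a b|a|g].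
  + exact: in_model_map1.
  + exact: in_model_mapM.
  + exact: in_model_mapV.
  + by apply: in_model_map_frame => //; case: g => /=; tauto.
Qed.

End Group32.

(** * The listed groups as models *)

Section Group245.
Let cls : word gen4 -> H245 := gclass (fun l r => List.In (l, r) rels245).
Let x := cls (Gen X4).
Let y := cls (Gen Y4).
Let u := cls (Gen U4).
Let v := cls (Gen V4).

Let rel l r : List.In (l, r) rels245 -> cls l = cls r.
Proof. exact: gclass_rel. Qed.

Let x4 : x ^+ 4 = 1.
Proof. by rewrite -gclassX; apply: rel; left. Qed.
Let y4 : y ^+ 4 = 1.
Proof. by rewrite -gclassX; apply: rel; right; left. Qed.
Let vu : [~ v, u] = 1.
Proof. by rewrite -gclassR; apply: rel; do 2 right; left. Qed.
Let xv : x ^+ 2 = v ^+ 2.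
Proof. by rewrite -!gclassX; apply: rel; do 3 right; left. Qed.
Let yx : x ^+ 2 = [~ y, x].
Proof. by rewrite -gclassX -gclassR; apply: rel; do 4 right; left. Qed.
Let vy : x ^+ 2 = [~ v, y].
Proof. by rewrite -gclassX -gclassR; apply: rel; do 5 right; left. Qed.
Let yu : y ^+ 2 = u ^+ 2.
Proof. by rewrite -!gclassX; apply: rel; do 6 right; left. Qed.
Let ux : y ^+ 2 = [~ u, x].
Proof. by rewrite -gclassX -gclassR; apply: rel; do 7 right; left. Qed.
Let uy : x ^+ 2 * y ^+ 2 = [~ u, y].
Proof. by rewrite -!gclassX -gclassM -gclassR; apply: rel; do 8 right; left. Qed.
Let vx : x ^+ 2 * y ^+ 2 = [~ v, x].
Proof. by rewrite -!gclassX -gclassM -gclassR; apply: rel; do 9 right; left. Qed.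

Lemma isomorphic_H245 : isomorphic H245 (model table245).
Proof.
have x_y : x ^ y = x^-1 := inverse_of_relation yx.
have u4 : u ^+ 4 = 1 by rewrite (expgnA u 2 2) -yu -expgnA y4.
have v4 : v ^+ 4 = 1 by rewrite (expgnA v 2 2) -xv -expgnA x4.
have u_x : u ^ x = u^-1 by apply: inverse_of_relation_sym => //; rewrite -yu.
have v_y : v ^ y = v^-1 by apply: inverse_of_relation_sym => //; rewrite -xv.
have st : central_involutions (x ^+ 2) (y ^+ 2).
  split; rewrite -?expgnA //; apply: presented_commute => -[].
  - exact/commute_sym/commuteX.
  - exact: commute_sqr_inverted.
  - exact/commute_sym/commute_inverted_sqr.
  - by rewrite xv; apply/commute_sym/commuteX.
  - exact/commute_sym/commute_inverted_sqr.
  - exact/commute_sym/commuteX.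
  - by rewrite yu; apply/commute_sym/commuteX.
  - exact/commute_sym/commute_inverted_sqr.
have fr : frame (x ^+ 2) (y ^+ 2) [:: v; u; y; x] table245.
  by rewrite /= -ux -uy -yx -yu -xv -vx -vy vu.
pose f g : model table245 := match g with
  | X4 => ([tuple false; false; false; true], p0)
  | Y4 => ([tuple false; false; true; false], p0)
  | U4 => ([tuple false; true; false; false], p0)
  | V4 => ([tuple true; false; false; false], p0) end.
have [|F FM Fgen] := @presented_lift _ rels245 _ f.
  by move=> l r; do 10?[case=> [[<- <-]|]] => //; apply: model_eq.
apply: (model_isomorphic_of st fr _ FM) => //.
- by rewrite expg2 FM Fgen; apply: model_eq.
- by rewrite expg2 FM Fgen; apply: model_eq.
- apply: presented_ind => [|a b|a|g].
  + exact: in_model_map1.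
  + exact: in_model_mapM.
  + exact: in_model_mapV.
  + by apply: in_model_map_frame => //; case: g => /=; tauto.
Qed.

End Group245.

Section Quaternions.

Lemma quaternion_generators : exists i j : Q8,
  [/\ i ^+ 4 = 1, i ^+ 2 <> 1, j ^+ 2 = i ^+ 2, [~ i, j] = i ^+ 2
    & forall x, commute (i ^+ 2) x].
Proof.
have isoG := isog_refl [set: 'Q_8]%G.
have [[i j] genG [_ j2 ij]] :=
  generators_quaternion (n := 3) (G := [set: 'Q_8]%G) isT isoG.
have [_ _ oi _] := genG.
have [_ _ [Z_Q8 _ _ _ _] _ _] := quaternion_structure (n := 3) isT genG isoG.
have i4 : i ^+ 4 = 1 by have := expg_order i; rewrite (oi : #[i] = 4).
exists i, j; split=> //.
- by move/eqP; rewrite -order_dvdn oi.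
- rewrite /commg ij -invgM -expg2; apply: mulg1_eq.
  by rewrite -expgnDr.
- move=> x; have : i ^+ 2 \in 'Z([set: 'Q_8])%g by rewrite Z_Q8 cycle_id.
  by case/centerP=> _; apply; rewrite inE.
Qed.

Lemma model_map_onto (G : finGroupType) c (s t : G) es :
    central_involutions s t -> frame s t es c -> independent s t ->
    anisotropic c -> #|G| = #|{: model c}| ->
  forall g, exists x : model c, model_map s t es x = g.
Proof.
move=> st fr ind an cardG g.
have inj : injective (@model_map G s t es c).
  have [phi phiE] := multiplicative_of (model_mapM st fr).
  have ker (x y : model c) :
      model_map s t es x = model_map s t es y -> x * y^-1 = 1.
    move=> xy; apply: (model_map_eq1 st fr ind an).
    by rewrite (model_mapM st fr) (gmorphV (model_mapM st fr)) xy mulgV.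
  by move=> x y /ker; apply: divg1_eq.
have := inj_card_onto inj; rewrite cardG leqnn => /(_ isT g)/codomP[x ->].
by exists x.
Qed.

Lemma card_model c : #|{: model c}| = (2 ^ size c * 4)%N.
Proof. by rewrite card_prod card_tuple card_prod card_bool. Qed.

Lemma card_Q8 : #|{: 'Q_8}| = 8.
Proof. by rewrite -cardsT (@card_quaternion 3). Qed.

Variables i j : Q8.
Hypotheses (i4 : i ^+ 4 = 1) (i2 : i ^+ 2 <> 1).
Hypotheses (ji : j ^+ 2 = i ^+ 2) (ij : [~ i, j] = i ^+ 2).

Hypothesis i2C : forall x, commute (i ^+ 2) x.

Definition C4_gen : C4 := 1%R.

Lemma C4_genP :
  [/\ C4_gen ^+ 4 = 1, C4_gen ^+ 2 <> 1 & forall x y : C4, commute x y].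
Proof.
split; [by apply/eqP | by apply/eqP | exact: Zp_addC ].
Qed.

Lemma pairX (A B : groupType) (a : A) (b : B) n :
  ((a, b) : A * B)%type ^+ n = (a ^+ n, b ^+ n).
Proof. by elim: n => // n IH; rewrite !expgS IH. Qed.

Lemma pair_eq (A B : groupType) (a a' : A) (b b' : B) :
  a = a' -> b = b' -> (a, b) = (a', b').
Proof. by move=> -> ->. Qed.

Lemma pairR (A B : groupType) (a a' : A) (b b' : B) :
  [~ ((a, b) : A * B)%type, (a', b')] = ([~ a, a'], [~ b, b']).
Proof. by []. Qed.

Lemma frame_Q8C4 : let s : (Q8 * C4)%type := (i ^+ 2, 1) in
  let t : (Q8 * C4)%type := (1, C4_gen ^+ 2) in
  [/\ central_involutions s t, independent s t &
   frame s t [:: ((1, C4_gen) : (Q8 * C4)%type); (i, 1); (j, 1)] tableQ8C4].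
Proof.
have [g44 g42 cC] := C4_genP; move=> s t.
split.
- split=> [||[q c]|[q c]]; rewrite ?pairX -?expgnA ?i4 ?g44 ?expg1n //.
  + by apply: pair_eq; [apply: i2C | apply: cC].
  + by apply: pair_eq; [apply/commute_sym/commute1 | apply: cC].
- by split=> [/(congr1 fst)/i2|/(congr1 snd)/g42|/(congr1 fst)/i2].
- by rewrite /= !pairX !pairR !expg1n ji !comm1g !commg1 ij.
Qed.

Lemma isomorphic_Q8C4 : isomorphic (Q8 * C4)%type (model tableQ8C4).
Proof.
have [st ind fr] := frame_Q8C4; apply: isomorphic_sym.
apply: (model_isomorphic st fr ind) => //.
apply: (model_map_onto st fr ind) => //.
by rewrite card_model card_prod card_Q8 card_ord.
Qed.

Lemma frame_Q8Q8 : let s : (Q8 * Q8)%type := (i ^+ 2, 1) in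
  let t : (Q8 * Q8)%type := (1, i ^+ 2) in
  [/\ central_involutions s t, independent s t &
   frame s t [:: ((i, 1) : (Q8 * Q8)%type); (j, 1); (1, i); (1, j)] tableQ8Q8].
Proof.
move=> s t; split.
- split=> [||[q c]|[q c]]; rewrite ?pairX -?expgnA ?i4 ?expg1n //.
  + by apply: pair_eq; [apply: i2C | apply/commute_sym/commute1].
  + by apply: pair_eq; [apply/commute_sym/commute1 | apply: i2C].
- by split=> [/(congr1 fst)/i2|/(congr1 snd)/i2|/(congr1 fst)/i2].
- by rewrite /= !pairX !pairR !expg1n ji !comm1g !commg1 ij.
Qed.

Lemma isomorphic_Q8Q8 : isomorphic (Q8 * Q8)%type (model tableQ8Q8).
Proof.
have [st ind fr] := frame_Q8Q8; apply: isomorphic_sym.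
apply: (model_isomorphic st fr ind) => //.
apply: (model_map_onto st fr ind) => //.
by rewrite card_model card_prod card_Q8.
Qed.

Lemma quaternion_involution (z : Q8) : has_order z 2 -> z = i ^+ 2.
Proof.
case=> _ z2 z1; have [st ind fr] := frame_Q8C4.
have surj := model_map_onto st fr ind isT.
have [|x xz] := surj _ ((z, 1) : (Q8 * C4)%type).
  by rewrite card_model card_prod card_Q8 card_ord.
have x0 : tval x.1 = nseq 3 false.
  by apply: (model_map_square st fr ind isT); rewrite xz pairX z2 expg1n.
move: xz; rewrite /model_map x0 /= !mul1g.
case: x.2 => [[] []] /= /(congr1 fst) /=; rewrite ?mulg1 //.
- by move=> e; case: (z1 1%N isT); rewrite expg1.
- by move=> e; case: (z1 1%N isT); rewrite expg1.
Qed.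

(** Q8 is presented by the relations between i and j. *)
Lemma quaternion_lift (H : groupType) (g h : H) :
    (forall x, commute (g ^+ 2) x) -> g ^+ 4 = 1 -> h ^+ 2 = g ^+ 2 ->
    [~ g, h] = g ^+ 2 ->
  exists psi : Q8 -> H, [/\ {morph psi : x y / x * y}, psi i = g & psi j = h].
Proof.
move=> gC g4_1 hg gh; have [st ind fr] := frame_Q8C4.
have stH : central_involutions (g ^+ 2) (1 : H).
  by split; rewrite -?expgnA ?expg1n // => x; apply/commute_sym/commute1.
have frH : frame (g ^+ 2) 1 [:: 1; g; h] tableQ8C4.
  by rewrite /= !comm1g gh hg expg1n.
have PhiM := model_mapM st fr.
have [|Psi PhiK PsiK] := gmorph_bij PhiM (fun x => model_map_eq1 st fr ind isT).
  apply: (model_map_onto st fr ind) => //.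
  by rewrite card_model card_prod card_Q8 card_ord.
have PsiM : {morph Psi : x y / x * y}.
  by move=> x y; rewrite -{1}(PsiK x) -{1}(PsiK y) -PhiM PhiK.
pose psi (q : Q8) := model_map (g ^+ 2) 1 [:: 1; g; h] (Psi (q, 1)).
exists psi; split.
- move=> x y; rewrite /psi -(model_mapM stH frH) -PsiM.
  by congr (model_map _ _ _ (Psi _)); apply: pair_eq; rewrite ?mulg1.
- pose e : model tableQ8C4 := ([tuple false; true; false], p0).
  have -> : psi i = model_map (g ^+ 2) 1 [:: 1; g; h] e.
    rewrite /psi -(PhiK e); congr (model_map _ _ _ (Psi _)).
    by apply: pair_eq; rewrite /= ?mulg1 ?mul1g.
  by rewrite /model_map /= mul1g !mulg1.
- pose e : model tableQ8C4 := ([tuple false; false; true], p0).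
  have -> : psi j = model_map (g ^+ 2) 1 [:: 1; g; h] e.
    rewrite /psi -(PhiK e); congr (model_map _ _ _ (Psi _)).
    by apply: pair_eq; rewrite /= ?mulg1 ?mul1g.
  by rewrite /model_map /= mul1g !mulg1 mul1g.
Qed.

(** Q8 is generated by i and j: a positive word suffices for each element. *)
Lemma quaternion_ind (P : Q8 -> Prop) :
    P 1 -> (forall a b, P a -> P b -> P (a * b)) -> P i -> P j -> forall q, P q.
Proof.
move=> P1 PM Pi Pj q; have [st ind fr] := frame_Q8C4.
have [|x xq] := model_map_onto st fr ind isT _ ((q, 1) : (Q8 * C4)%type).
  by rewrite card_model card_prod card_Q8 card_ord.
have Pii : P (i ^+ 2) by apply: PM.
case: x xq => [[[|a [|b [|c [|]]]] //= sv] w] /(congr1 fst) /= <-.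
by case: a sv; case: b; case: c => sv; case: w => [[] []]; rewrite /ppow /=;
  rewrite ?mul1g ?mulg1; try exact: P1; repeat first [assumption | apply PM].
Qed.

End Quaternions.

Section Group16Q8.
Variables i j : Q8.
Hypotheses (i4 : i ^+ 4 = 1) (i2 : i ^+ 2 <> 1).
Hypotheses (ji : j ^+ 2 = i ^+ 2) (ij : [~ i, j] = i ^+ 2).
Hypothesis i2C : forall x, commute (i ^+ 2) x.

Let rel16 := fun l r => List.In (l, r) rels16.
Let a : P16 := gclass rel16 (Gen X2).
Let b : P16 := gclass rel16 (Gen Y2).

Let R (l r : (P16 * Q8)%type) := l = (P16_x2y2, 1) /\ r = (1, i ^+ 2).
Let cls := gclass R.

Let a4 : a ^+ 4 = 1.
Proof. by rewrite -gclassX; apply: (gclass_rel (R := rel16)); left. Qed.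
Let b4 : b ^+ 4 = 1.
Proof. by rewrite -gclassX; apply: (gclass_rel (R := rel16)); right; left. Qed.
Let ba : a ^+ 2 = [~ b, a].
Proof.
by rewrite -gclassX -gclassR; apply: (gclass_rel (R := rel16)); do 2 right; left.
Qed.

Let ab2 : P16_x2y2 = a ^+ 2 * b ^+ 2.
Proof. by rewrite -!gclassX -gclassM. Qed.

Let a2C c : commute (a ^+ 2) c.
Proof.
apply: presented_commute => -[]; first exact/commute_sym/commuteX.
exact/commute_sqr_inverted/inverse_of_relation.
Qed.

Let b2C c : commute (b ^+ 2) c.
Proof.
apply: presented_commute => -[]; last exact/commute_sym/commuteX.
exact/commute_sym/commute_inverted_sqr/inverse_of_relation.
Qed.

(** Q8 maps to the model by sending i and j to the first two generators, P16 maps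
to it by its presentation, and the two images commute. *)
Lemma isomorphic_P16_central_Q8 :
  isomorphic (P16_central_Q8 (i ^+ 2)) (model table16Q8).
Proof.
pose s : P16_central_Q8 (i ^+ 2) := cls (a ^+ 2, 1).
pose t : P16_central_Q8 (i ^+ 2) := cls (b ^+ 2, 1).
have clsM x y : cls x * cls y = cls (x * y) by rewrite /cls gclassM.
have clsX x n : cls x ^+ n = cls (x ^+ n) by rewrite /cls gclassX.
have clsR x y : [~ cls x, cls y] = cls [~ x, y] by rewrite /cls gclassR.
have st : central_involutions s t.
  split=> [||u|u]; rewrite ?clsX ?pairX -?expgnA ?a4 ?b4 ?expg1n //.
  - have [[c q] <-] := gclass_surj u; rewrite /commute !clsM; congr cls.
    by apply: pair_eq; [apply: a2C | apply/commute_sym/commute1].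
  - have [[c q] <-] := gclass_surj u; rewrite /commute !clsM; congr cls.
    by apply: pair_eq; [apply: b2C | apply/commute_sym/commute1].
have stE : cls (1, i ^+ 2) = ppow s t p3.
  rewrite /ppow /= clsM; apply/esym/(gclass_rel (R := R)); split=> //.
  by rewrite ab2; apply: pair_eq; rewrite ?mulg1.
have fr : frame s t [:: cls (1, i); cls (1, j); cls (b, 1); cls (a, 1)] table16Q8.
  by rewrite /= !clsX !pairX !clsR !pairR !comm1g !commg1 !expg1n ij ji -ba stE.
pose fa g : model table16Q8 := match g with
  | X2 => ([tuple false; false; false; true], p0)
  | Y2 => ([tuple false; false; true; false], p0) end.
have [|Fa FaM Fagen] := @presented_lift _ rels16 _ fa.
  by move=> l r; do 3?[case=> [[<- <-]|]] => //; apply: model_eq.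
pose mi : model table16Q8 := ([tuple true; false; false; false], p0).
pose mj : model table16Q8 := ([tuple false; true; false; false], p0).
have mi2 : mi ^+ 2 = model_central table16Q8 p3 by apply: model_eq.
have [||||psi [psiM psi_i psi_j]] :=
    quaternion_lift i4 i2 ji ij i2C (g := mi) (h := mj).
- by move=> x; rewrite mi2; apply: model_centralC.
- exact: model_eq.
- exact: model_eq.
- exact: model_eq.
have comm c q : commute (Fa c) (psi q).
  have genC (m : model table16Q8) :
      commute m mi -> commute m mj -> commute m (psi q).
    move=> mCi mCj.
    apply: (quaternion_ind i4 i2 ji ij i2C (P := fun q => commute m (psi q))).
    - by rewrite (gmorph1 psiM); apply: commute1.
    - by move=> x y cx cy; rewrite psiM; apply: commuteM.
    - by rewrite psi_i.
    - by rewrite psi_j.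
  move: c; apply: presented_ind => [|x y cx cy|x cx|g].
  - by rewrite (gmorph1 FaM); apply/commute_sym/commute1.
  - by rewrite FaM; apply/commute_sym/commuteM; apply: commute_sym.
  - by rewrite (gmorphV FaM); apply/commute_sym/commuteV/commute_sym.
  - by rewrite Fagen; apply: genC; apply: model_eq; case: g.
have Fa_a : Fa a = fa X2 := Fagen X2.
have Fa_b : Fa b = fa Y2 := Fagen Y2.
have [||||F FM FE] := @quotient_lift _ R _ (fun x => Fa x.1 * psi x.2).
- move=> [c q] [c' q'] /=; rewrite FaM psiM mulgACA //.
- move=> [c q] /=; rewrite (gmorphV FaM) (gmorphV psiM) -invgM.
  by rewrite (comm c q).
- by rewrite /= (gmorph1 FaM) (gmorph1 psiM) mulg1.
- move=> x y [-> ->] /=; rewrite (gmorph1 FaM) (gmorph1 psiM) mulg1 mul1g.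
  rewrite ab2 !expg2 !FaM psiM psi_i Fa_a Fa_b.
  exact: model_eq.
apply: (model_isomorphic_of st fr _ FM) => //.
- by rewrite FE /= (gmorph1 psiM) mulg1 expg2 FaM Fa_a; apply: model_eq.
- by rewrite FE /= (gmorph1 psiM) mulg1 expg2 FaM Fa_b; apply: model_eq.
pose Im := in_model_map table16Q8 s t
  [:: cls (1, i); cls (1, j); cls (b, 1); cls (a, 1)].
have ImM u v : Im u -> Im v -> Im (u * v) by apply: in_model_mapM.
move=> u; rewrite -/(Im u); have [[c q] <-] := gclass_surj u.
have -> : gclass R (c, q) = cls (c, 1) * cls (1, q).
  by rewrite clsM; congr cls; apply: pair_eq; rewrite ?mulg1 ?mul1g.
apply/ImM.
- move: c; apply: presented_ind => [|x y cx cy|x cx|g].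
  + exact: in_model_map1.
  + have -> : cls (x * y, 1) = cls (x, 1) * cls (y, 1).
      by rewrite clsM; congr cls; apply: pair_eq; rewrite ?mulg1.
    exact: ImM.
  + have -> : cls (x^-1, 1) = (cls (x, 1))^-1.
      by rewrite /cls -gclassV; congr gclass; apply: pair_eq; rewrite ?invg1.
    exact: in_model_mapV.
  + by apply: in_model_map_frame => //; case: g => /=; tauto.
- move: q; refine (quaternion_ind i4 i2 ji ij i2C
    (P := fun q => Im (cls (1, q))) _ _ _ _) => [|x y cx cy||].
  + exact: in_model_map1.
  + have -> : cls (1, x * y) = cls (1, x) * cls (1, y).
      by rewrite clsM; congr cls; apply: pair_eq; rewrite ?mulg1.
    exact: ImM.
  + by apply: in_model_map_frame => //=; tauto.
  + by apply: in_model_map_frame => //=; tauto.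
Qed.

End Group16Q8.

(** * The classification *)

Lemma isomorphic_trivial_prod (G : groupType) : isomorphic G ('I_1 * G)%type.
Proof.
apply: (@isomorphic_of _ _ (fun x : G => (1, x) : 'I_1 * G)%type) => [x y|].
  by congr pair; rewrite mulg1.
by exists snd => // -[e x]; congr pair; rewrite [RHS]ord1.
Qed.

Definition listed_group (H : groupType) :=
  [\/ inverted_by_order4 H,
      isomorphic H (Q8 * C4)%type \/ isomorphic H (Q8 * Q8)%type,
      exists2 z : Q8, has_order z 2 & isomorphic H (P16_central_Q8 z)
    | isomorphic H H32 \/ isomorphic H H245].

Lemma good_listed_group H : listed_group H -> good H.
Proof.
have [i [j [i4 i2 ji ij i2C]]] := quaternion_generators.
case=> [|[] isoH|[z z2 isoH]|[] isoH].
- exact: good_inverted.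
- apply/(good_isomorphic isoH)/good_isomorphic/good_model.
    exact: isomorphic_Q8C4 i4 i2 ji ij i2C.
  by [].
- apply/(good_isomorphic isoH)/good_isomorphic/good_model.
    exact: isomorphic_Q8Q8 i4 i2 ji ij i2C.
  by [].
- move: isoH; rewrite (quaternion_involution i4 i2 ji ij i2C z2) => isoH.
  apply/(good_isomorphic isoH)/good_isomorphic/good_model.
    exact: isomorphic_P16_central_Q8 i4 i2 ji ij i2C.
  by [].
- exact/(good_isomorphic isoH)/(good_isomorphic isomorphic_H32)/good_model.
- exact/(good_isomorphic isoH)/(good_isomorphic isomorphic_H245)/good_model.
Qed.

Lemma listed_model c :
  listed_table c -> listed_group (model c).
Proof.
have [i [j [i4 i2 ji ij i2C]]] := quaternion_generators.
case=> [->|->|->|[]->].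
- by apply: Or42; left; apply: isomorphic_sym (isomorphic_Q8C4 i4 i2 ji ij i2C).
- by apply: Or42; right; apply: isomorphic_sym (isomorphic_Q8Q8 i4 i2 ji ij i2C).
- apply: Or43; exists (i ^+ 2).
    split=> // [|[|[|m]]] //; first by rewrite -expgnA.
  exact: isomorphic_sym (isomorphic_P16_central_Q8 i4 i2 ji ij i2C).
- by apply: Or44; left; apply: isomorphic_sym isomorphic_H32.
- by apply: Or44; right; apply: isomorphic_sym isomorphic_H245.
Qed.

Theorem mainTheorem1 (p : nat) (K : comNzRingType) (G : groupType) :
  prime p -> p \in [pchar K]%R ->
  ~ commutative_group G -> locally_finite G -> is_p_group p G ->
  unit_subgroup (@symmetric_unit K G) <->
  p = 2 /\
  exists E H : groupType,
    [/\ elementary_abelian 2 E,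
        isomorphic G (E * H)%type
      & [\/ inverted_by_order4 H,
            isomorphic H (Q8 * C4)%type \/ isomorphic H (Q8 * Q8)%type,
            exists2 z : Q8, has_order z 2 & isomorphic H (P16_central_Q8 z)
          | isomorphic H H32 \/ isomorphic H H245]].
Proof.
move=> pr_p charp nabG _ pG; split=> [subS|[p2 [E [H [elE isoG listH]]]]].
  have p2 : p = 2.
    have [//|odd_p] := even_prime pr_p.
    by case: nabG; apply: (commutative_of_symmetric charp pG odd_p subS).
  split=> //; have goodG := good_of_symmetric charp pG subS.
  have [invG|[E [c [elE isoG /listed_model listc]]]] := good_structure goodG nabG.
    exists 'I_1, G; split; [|exact: isomorphic_trivial_prod|exact: Or41].
    have triv (e f : 'I_1) : e = f by rewrite [e]ord1 [f]ord1.
    by split=> [x y|x]; apply: triv.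
  by exists E, (model c).
apply: unit_subgroup_of_comm; apply: comm_of_good; first by rewrite -p2.
exact: good_isomorphic isoG (good_prod elE (good_listed_group listH)).
Qed.
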